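(* Let $\lambda\in\mathbb{C}\setminus\{0\}$, $f_\lambda(z)=\exp(\lambda z)$, and let $a\in\mathbb{C}$, $a\ne0,1$. Then $$R_\lambda^*(\gamma_a)(z)=\frac{1}{f_\lambda'(a)}\,\gamma_{f_\lambda(a)}(z)-\frac{a}{f_\lambda'(1)}\,\gamma_{f_\lambda(1)}(z).$$
   Context: For $a\in\mathbb{C}$, $\gamma_a(z)=\frac{a(a-1)}{z(z-1)(z-a)}$ (so $\gamma_1=0$ identically). The Ruelle (push-forward) operator of $f_\lambda$ is $$R_\lambda^*(\varphi)(z)=\sum_{\xi_i}\varphi(\xi_i(z))\,(\xi_i'(z))^2=\frac{1}{\lambda^2z^2}\sum_{\xi_i}\varphi(\xi_i(z)),$$ the sum being over all branches $\xi_i$ of $f_\lambda^{-1}$; it acts on $L_1(\mathbb{C})$. *)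

(* Defs.v *)
From Stdlib Require Import Reals List ClassicalEpsilon.
From Coquelicot Require Import Coquelicot.
Open Scope C_scope.

Definition Cexp (z : C) : C := RtoC (exp (Re z)) * (cos (Im z), sin (Im z)).

Definition fexp (lambda z : C) : C := Cexp (lambda * z).

(* Division in [C] is total with [x / 0 = 0], so [gamma 1] is identically zero,
   including at its would-be poles. *)
Definition gamma (a z : C) : C :=
  (a * (a - 1)) / (z * (z - 1) * (z - a)).

Definition holomorphic_at (g : C -> C) (z : C) : Prop :=
  locally z (fun w : C => ex_derive (K := C_AbsRing) (V := C_NormedModule) g w).

(* [xi] is only relevant near [z]. *)
Definition inverse_branch (g : C -> C) (z : C) (xi : C -> C) : Prop :=
  locally z (fun w : C => g (xi w) = w) /\ holomorphic_at xi z.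

(* A germ at [z] is the class of all functions agreeing near [z]; two local
   inverses define the same branch at [z] exactly when their germs are equal. *)
Definition germ (z : C) (xi : C -> C) : (C -> C) -> Prop :=
  fun eta => locally z (fun w : C => eta w = xi w).

Definition branch_germ (g : C -> C) (z : C) (G : (C -> C) -> Prop) : Prop :=
  exists xi, inverse_branch g z xi /\ G = germ z xi.

Definition germ_repr (G : (C -> C) -> Prop) : C -> C :=
  epsilon (inhabits (fun w : C => w)) G.

Definition list_sum {T : Type} (u : T -> C) (F : list T) : C :=
  fold_right (fun t s => u t + s) (RtoC 0) F.

(* Unordered summation: limit of the sums over finite subsets of [A], directed
   by inclusion (in [C] this amounts to absolute convergence). *)
Definition is_unordered_sum {T : Type} (A : T -> Prop) (u : T -> C) (s : C) : Prop :=
  forall eps : posreal, exists F0 : list T, List.Forall A F0 /\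
    forall F : list T, NoDup F -> List.Forall A F -> incl F0 F ->
      Rlt (Cmod (list_sum u F - s)) eps.

(* The summand phi(xi(z)) xi'(z)^2 depends on [xi] only through its germ at [z]. *)
Definition ruelle_term (phi : C -> C) (z : C) (G : (C -> C) -> Prop) : C :=
  phi (germ_repr G z) * C_derive (germ_repr G) z ^ 2.

Definition is_Ruelle (g phi : C -> C) (z s : C) : Prop :=
  is_unordered_sum (branch_germ g z) (ruelle_term phi z) s.

Definition ex_Ruelle (g phi : C -> C) (z : C) : Prop :=
  exists s : C, is_Ruelle g phi z s.

(* Meaningful only under [ex_Ruelle g phi z]; the sum is then unique. *)
Definition Ruelle (g phi : C -> C) (z : C) : C :=
  epsilon (inhabits (RtoC 0)) (is_Ruelle g phi z).

(* Main.v *)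
(* Partial fractions give
     gamma a w = (a - 1) (1/w - 1/(w - a)) - a (1/(w - 1) - 1/(w - a)).
   Writing z = exp L, the inverse branches of f take at z the values
   (L + 2 pi i k) / lambda, k an integer, with derivative 1 / (lambda z) there,
   so the Ruelle sum reduces to sums of the form
     sum_k 1/(s + 2 pi i k) - 1/(t + 2 pi i k) = 1/(e^s - 1) - 1/(e^t - 1)
   with s, t among L, L - lambda, L - lambda a.  This identity follows by
   iterating 1/(y^2 - 1) = (1/(y - 1) + 1/(-y - 1)) / 2 with y = e^(s/2), which
   writes 1/(e^s - 1) as the average of 1/(e^((s + 2 pi i k)/N) - 1) over N
   consecutive k for N a power of 2, and letting N tend to infinity by
   dominated convergence. *)

Require Import Defs.
From Stdlib Require Import ZArith Lra Lia List Permutation.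
From Stdlib Require Import Classical ClassicalEpsilon.
From Stdlib Require Import FunctionalExtensionality PropExtensionality.
From Stdlib Require Import Reals.
From Coquelicot Require Import Coquelicot.
(* [List] also defines a [list_sum]. *)
Require Import Defs.
Open Scope C_scope.

(** * Bounds on the exponential *)

Section RealBounds.
Open Scope R_scope.

(** The pivotal estimate is |h| / 12 <= |exp h - 1| for |Re h| <= 1 and |Im h| <= 3 PI / 2, a region
    where exp - 1 vanishes only at 0. It has two uses. It shows that a holomorphic local inverse of
    f is determined near z by its value at z, so that the germs of branches are exactly indexed by
    the integers. It also provides the dominating series in the limit N to infinity, and this
    dictates which N consecutive integers to average over: with k running from 0 to N - 1, the
    points (s + 2 pi i k) / N would approach the zero 2 pi i of exp - 1, and the contribution of the
    negative k, sitting at k + N, would be lost in the termwise limit. A centered window keeps the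
    imaginary parts close to [- PI, PI]. The constants are explicit but not optimized; everything
    rests on real inequalities for exp, sin and cos. *)

Lemma pow2_le_inv (x y : R) : 0 <= y -> x ^ 2 <= y ^ 2 -> x <= y.
Proof. intros Hy H. nra. Qed.

Lemma pow2_Rabs_le (x y : R) : Rabs x <= Rabs y -> x ^ 2 <= y ^ 2.
Proof.
  intros H. rewrite <- (pow2_abs x), <- (pow2_abs y).
  apply pow_incr. split; [apply Rabs_pos | exact H].
Qed.

(** Both sides are the tangent inequality 1 + x <= exp x, at x = r and at x = - r. *)
Lemma exp_minus_1_bounds (r : R) : r <= exp r - 1 <= r * exp r.
Proof.
  pose proof (exp_ineq1_le r) as H1. pose proof (exp_ineq1_le (- r)) as H2.
  pose proof (exp_pos r) as H3.
  assert (H4 : exp r * exp (- r) = 1).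
  { rewrite <- exp_plus. replace (r + - r) with 0 by ring. apply exp_0. }
  split; nra.
Qed.

Lemma exp_bounds_near_0 (r : R) : Rabs r <= 1 -> / 3 <= exp r <= 3.
Proof.
  intros H. apply Rabs_le_between in H.
  assert (H1 : exp r <= exp 1).
  { destruct (Rle_lt_or_eq_dec r 1) as [h | ->]; [lra | | lra].
    left. apply exp_increasing, h. }
  assert (H2 : exp (- r) <= exp 1).
  { destruct (Rle_lt_or_eq_dec (- r) 1) as [h | ->]; [lra | | lra].
    left. apply exp_increasing, h. }
  pose proof exp_le_3. pose proof (exp_pos r). pose proof (exp_pos (- r)).
  assert (H6 : exp r * exp (- r) = 1).
  { rewrite <- exp_plus. replace (r + - r) with 0 by ring. apply exp_0. }
  split; nra.
Qed.

Lemma exp_minus_1_upper (r : R) : Rabs r <= 1 -> Rabs (exp r - 1) <= 3 * Rabs r.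
Proof.
  intros H. pose proof (exp_bounds_near_0 r H). pose proof (exp_minus_1_bounds r).
  apply Rabs_le_between in H. unfold Rabs. repeat destruct Rcase_abs; nra.
Qed.

Lemma exp_minus_1_lower (r : R) : Rabs r <= 1 -> Rabs r / 3 <= Rabs (exp r - 1).
Proof.
  intros H. pose proof (exp_bounds_near_0 r H). pose proof (exp_minus_1_bounds r).
  apply Rabs_le_between in H. unfold Rabs. repeat destruct Rcase_abs; nra.
Qed.

Lemma exp_taylor_1 (r : R) : Rabs r <= 1 -> Rabs (exp r - 1 - r) <= 3 * r ^ 2.
Proof.
  intros H. pose proof (exp_bounds_near_0 r H). pose proof (exp_minus_1_bounds r).
  apply Rabs_le_between in H. unfold Rabs. repeat destruct Rcase_abs; nra.
Qed.

Lemma Rabs_sin_le (t : R) : Rabs (sin t) <= Rabs t.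
Proof.
  destruct (MVT_abs sin cos 0 t) as [c [H _]].
  { intros c _. apply derivable_pt_lim_sin. }
  rewrite sin_0, !Rminus_0_r in H. rewrite H.
  rewrite <- (Rmult_1_l (Rabs t)) at 2.
  apply Rmult_le_compat_r; [apply Rabs_pos |].
  apply Rabs_le, COS_bound.
Qed.

Lemma one_minus_cos (t : R) : 1 - cos t = 2 * sin (t / 2) ^ 2.
Proof.
  replace t with (2 * (t / 2)) at 1 by field. rewrite cos_2a_sin. ring.
Qed.

Lemma Rabs_cos_minus_1_le (t : R) : Rabs (cos t - 1) <= t ^ 2 / 2.
Proof.
  rewrite Rabs_minus_sym, one_minus_cos.
  pose proof (Rabs_sin_le (t / 2)) as H. apply Rsqr_le_abs_1 in H. unfold Rsqr in H.
  rewrite Rabs_pos_eq; nra.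
Qed.

Lemma Rabs_sin_minus_id_le (t : R) : Rabs (sin t - t) <= t ^ 2 / 2 * Rabs t.
Proof.
  destruct (MVT_abs (fun x => sin x - x) (fun x => cos x - 1) 0 t) as [c [H Hc]].
  { intros c _. apply derivable_pt_lim_minus;
      [apply derivable_pt_lim_sin | apply derivable_pt_lim_id]. }
  rewrite sin_0, !Rminus_0_r in H. rewrite H.
  apply Rmult_le_compat_r; [apply Rabs_pos |].
  apply Rle_trans with (c ^ 2 / 2); [apply Rabs_cos_minus_1_le |].
  revert Hc. unfold Rmin, Rmax. destruct Rle_dec; nra.
Qed.

(** Up to PI / 3 the mean value theorem applies with cos >= 1/2; beyond it sin t >= 1/2, while t / 6
    <= PI / 8 <= 1/2. The range is half of 3 PI / 2 because imaginary parts enter below through sin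
    (Im h / 2). *)
Lemma sin_lower_pos (t : R) : 0 <= t <= 3 * PI / 4 -> t / 6 <= sin t.
Proof.
  intros [Ht0 Ht1]. pose proof PI_RGT_0. pose proof PI_4.
  destruct (Rle_dec t (PI / 3)) as [h | h].
  - destruct (MVT_abs sin cos 0 t) as [c [HM Hc]].
    { intros c _. apply derivable_pt_lim_sin. }
    rewrite Rmin_left, Rmax_right in Hc by lra.
    rewrite sin_0, !Rminus_0_r in HM.
    assert (H3 : 1 / 2 <= cos c).
    { rewrite <- cos_PI3. apply cos_decr_1; lra. }
    rewrite (Rabs_pos_eq (sin t)), !Rabs_pos_eq in HM; try nra.
    apply sin_ge_0; lra.
  - apply Rle_trans with (1 / 2); [lra |]. rewrite <- sin_PI6.
    destruct (Rle_dec t (PI / 2)).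
    + apply sin_incr_1; lra.
    + rewrite <- (sin_PI_x t). apply sin_incr_1; lra.
Qed.

Lemma Rabs_sin_lower (t : R) :
  Rabs t <= 3 * PI / 4 -> Rabs t / 6 <= Rabs (sin t).
Proof.
  intros H. destruct (Rle_dec 0 t) as [h | h].
  - rewrite Rabs_pos_eq in * by lra. apply Rle_trans with (sin t); [| apply Rle_abs].
    apply sin_lower_pos; lra.
  - rewrite Rabs_left in * by lra. rewrite <- Rabs_Ropp, <- sin_neg.
    apply Rle_trans with (sin (- t)); [| apply Rle_abs].
    apply sin_lower_pos; lra.
Qed.

End RealBounds.

(** * The complex exponential and the size of exp h - 1 *)

Lemma Cexp_plus (s t : C) : Cexp (s + t) = Cexp s * Cexp t.
Proof.
  unfold Cexp. rewrite re_plus, im_plus, exp_plus, cos_plus, sin_plus.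
  unfold Cmult, RtoC; simpl. f_equal; ring.
Qed.

Lemma Cexp_0 : Cexp 0 = 1.
Proof.
  unfold Cexp, RtoC; simpl. rewrite exp_0, cos_0, sin_0.
  unfold Cmult; simpl. f_equal; ring.
Qed.

Lemma Cexp_neq0 (s : C) : Cexp s <> 0.
Proof.
  intros H. apply C1_nz. rewrite <- Cexp_0.
  replace (RtoC 0) with (s + - s) by ring. rewrite Cexp_plus, H. ring.
Qed.

Lemma Cexp_opp (s : C) : Cexp (- s) = / Cexp s.
Proof.
  assert (H : Cexp s * Cexp (- s) = 1).
  { rewrite <- Cexp_plus. replace (s + - s) with (RtoC 0) by ring. apply Cexp_0. }
  rewrite <- (Cmult_1_l (/ Cexp s)), <- H. field. apply Cexp_neq0.
Qed.

Lemma Cexp_minus (s t : C) : Cexp (s - t) = Cexp s / Cexp t.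
Proof. unfold Cminus, Cdiv. rewrite Cexp_plus, Cexp_opp. reflexivity. Qed.

Lemma im_le_Cmod (c : C) : (Rabs (Im c) <= Cmod c)%R.
Proof.
  apply Rle_trans with (2 := Rmax_Cmod c). apply Rmax_r.
Qed.

(** Separates the real and imaginary parts of h into two nonnegative terms, so that upper bounds,
    lower bounds and the kernel of exp all follow from real facts about each term. *)
Lemma Cmod_Cexp_minus_1 (h : C) :
  (Cmod (Cexp h - 1) ^ 2 =
   (exp (Re h) - 1) ^ 2 + 4 * exp (Re h) * sin (Im h / 2) ^ 2)%R.
Proof.
  rewrite Cmod2_alt.
  assert (H : (sin (Im h) ^ 2 = 1 - cos (Im h) ^ 2)%R).
  { pose proof (sin2_cos2 (Im h)) as H. unfold Rsqr in H. lra. }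
  pose proof (one_minus_cos (Im h)) as H'.
  replace (4 * exp (Re h) * sin (Im h / 2) ^ 2)%R
    with (2 * exp (Re h) * (1 - cos (Im h)))%R by (rewrite H'; ring).
  replace (Re (Cexp h - 1)) with (exp (Re h) * cos (Im h) - 1)%R
    by (unfold Cexp; destruct h; simpl; ring).
  replace (Im (Cexp h - 1)) with (exp (Re h) * sin (Im h))%R
    by (unfold Cexp; destruct h; simpl; ring).
  rewrite (Rpow_mult_distr _ (sin _)), H. ring.
Qed.

Lemma Cexp_minus_1_upper (h : C) :
  (Cmod h <= 1 -> Cmod (Cexp h - 1) <= 3 * Cmod h)%R.
Proof.
  intros H. pose proof (re_le_Cmod h) as Hr.
  assert (Hr1 : (Rabs (Re h) <= 1)%R) by lra.
  pose proof (exp_minus_1_upper _ Hr1) as H1. pose proof (exp_bounds_near_0 _ Hr1) as H2.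
  pose proof (Rabs_sin_le (Im h / 2)) as H3.
  pose proof (Cmod_ge_0 h).
  apply pow2_le_inv; [lra |].
  rewrite Rpow_mult_distr, Cmod_Cexp_minus_1, (Cmod2_alt h).
  apply pow2_Rabs_le in H3.
  replace (3 * Rabs (Re h))%R with (Rabs (3 * Re h)) in H1
    by (rewrite Rabs_mult, (Rabs_pos_eq 3); lra).
  apply pow2_Rabs_le in H1.
  nra.
Qed.

(** The 12 comes from the sine term: |sin (Im h / 2)| >= |Im h| / 12, with a factor 4 exp (Re h) >=
    4/3. *)
Lemma Cexp_minus_1_lower (h : C) :
  (Rabs (Re h) <= 1 -> Rabs (Im h) <= 3 * PI / 2 ->
   Cmod h / 12 <= Cmod (Cexp h - 1))%R.
Proof.
  intros Hr Hi.
  pose proof (exp_minus_1_lower _ Hr) as H1. pose proof (exp_bounds_near_0 _ Hr) as H2.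
  assert (H3 : (Rabs (Im h / 2) / 6 <= Rabs (sin (Im h / 2)))%R).
  { apply Rabs_sin_lower. unfold Rdiv at 1.
    rewrite Rabs_mult, (Rabs_pos_eq (/ 2)); lra. }
  apply pow2_le_inv; [apply Cmod_ge_0 |].
  unfold Rdiv at 1. rewrite Rpow_mult_distr, Cmod_Cexp_minus_1, (Cmod2_alt h).
  replace (Rabs (Re h) / 3)%R with (Rabs (Re h / 3)) in H1
    by (unfold Rdiv; rewrite Rabs_mult, (Rabs_pos_eq (/ 3)); lra).
  replace (Rabs (Im h / 2) / 6)%R with (Rabs (Im h / 12)) in H3
    by (unfold Rdiv; rewrite !Rabs_mult, !(Rabs_pos_eq (/ _)); lra).
  apply pow2_Rabs_le in H1, H3.
  nra.
Qed.

Lemma Cmod_le_Rabs (c : C) : (Cmod c <= Rabs (Re c) + Rabs (Im c))%R.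
Proof.
  pose proof (Rabs_pos (Re c)). pose proof (Rabs_pos (Im c)).
  apply pow2_le_inv; [lra |].
  rewrite Cmod2_alt, <- (pow2_abs (Re c)), <- (pow2_abs (Im c)). nra.
Qed.

Lemma Cexp_taylor_1 (h : C) :
  (Cmod h <= 1 -> Cmod (Cexp h - 1 - h) <= 5 * Cmod h ^ 2)%R.
Proof.
  intros H. pose proof (re_le_Cmod h) as Hr. pose proof (im_le_Cmod h) as Hi.
  assert (Hr1 : (Rabs (Re h) <= 1)%R) by lra.
  assert (Hi1 : (Rabs (Im h) <= 1)%R) by lra.
  pose proof (exp_minus_1_upper _ Hr1) as H1. pose proof (exp_bounds_near_0 _ Hr1) as H2.
  pose proof (exp_taylor_1 _ Hr1) as H3.
  pose proof (Rabs_cos_minus_1_le (Im h)) as H4.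
  pose proof (Rabs_sin_minus_id_le (Im h)) as H5.
  apply Rle_trans with (1 := Cmod_le_Rabs _). rewrite Cmod2_alt.
  replace (Re (Cexp h - 1 - h))
    with (exp (Re h) * (cos (Im h) - 1) + (exp (Re h) - 1 - Re h))%R
    by (unfold Cexp; destruct h; simpl; ring).
  replace (Im (Cexp h - 1 - h))
    with (exp (Re h) * (sin (Im h) - Im h) + (exp (Re h) - 1) * Im h)%R
    by (unfold Cexp; destruct h; simpl; ring).
  eapply Rle_trans.
  { apply Rplus_le_compat; apply Rabs_triang. }
  rewrite !Rabs_mult, (Rabs_pos_eq (exp (Re h))) by lra.
  rewrite <- (pow2_abs (Im h)) in *. rewrite <- (pow2_abs (Re h)) in *.
  pose proof (Rabs_pos (Re h)). pose proof (Rabs_pos (Im h)).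
  set (x := Rabs (Re h)) in *. set (y := Rabs (Im h)) in *.
  assert (K1 : (exp (Re h) * Rabs (cos (Im h) - 1) <= 3 * (y ^ 2 / 2))%R)
    by (apply Rmult_le_compat; try lra; apply Rabs_pos).
  assert (K2 : (exp (Re h) * Rabs (sin (Im h) - Im h) <= 3 * (y ^ 2 / 2 * y))%R)
    by (apply Rmult_le_compat; try lra; apply Rabs_pos).
  assert (K3 : (Rabs (exp (Re h) - 1) * y <= 3 * x * y)%R)
    by (apply Rmult_le_compat_r; lra).
  assert (K4 : (y ^ 2 * y <= y ^ 2 * 1)%R)
    by (apply Rmult_le_compat_l; [apply pow2_ge_0 | exact Hi1]).
  (* With 2 x y <= x ^ 2 + y ^ 2 the four terms add up to at most 9/2 (x ^ 2 + y ^ 2). *)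
  pose proof (pow2_ge_0 (x - y)). pose proof (pow2_ge_0 x). pose proof (pow2_ge_0 y). lra.
Qed.

(** * Inverse branches *)

Definition period (k : Z) : C := (0, 2 * PI * IZR k)%R.

Lemma Cexp_period (k : Z) : Cexp (period k) = 1.
Proof.
  apply Ceq_minus, Cmod_eq_0.
  assert (H : (Cmod (Cexp (period k) - 1) ^ 2 = 0)%R).
  { rewrite Cmod_Cexp_minus_1. simpl.
    rewrite (sin_eq_0_1 (2 * PI * IZR k / 2)) by (exists k; field).
    rewrite exp_0. ring. }
  apply Rsqr_0_uniq. unfold Rsqr. lra.
Qed.

Lemma Cexp_eq_1 (s : C) : Cexp s = 1 -> exists k : Z, s = period k.
Proof.
  intros H.
  assert (H0 : (Cmod (Cexp s - 1) ^ 2 = 0)%R).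
  { rewrite H. replace (1 - 1) with (RtoC 0) by ring. rewrite Cmod_0. ring. }
  rewrite Cmod_Cexp_minus_1 in H0. pose proof (exp_pos (Re s)) as H1.
  pose proof (pow2_ge_0 (exp (Re s) - 1)) as H2.
  pose proof (pow2_ge_0 (sin (Im s / 2))) as H3.
  assert (Hr : exp (Re s) = exp 0).
  { rewrite exp_0. apply Rminus_diag_uniq, Rsqr_0_uniq. unfold Rsqr. nra. }
  assert (Hi : sin (Im s / 2) = 0%R).
  { apply Rsqr_0_uniq. unfold Rsqr. nra. }
  apply exp_inv in Hr. destruct (sin_eq_0_0 _ Hi) as [k Hk].
  exists k. destruct s as [x y]; simpl in *. unfold period. f_equal; lra.
Qed.

(* A bound on [Re h] is implied, since [exp (Re h)] is within 1/2 of 1. *)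
Lemma Cexp_minus_1_lower_strip (h : C) :
  (Rabs (Im h) <= 3 * PI / 2 -> Cmod (Cexp h - 1) <= 1 / 2 ->
   Cmod h / 12 <= Cmod (Cexp h - 1))%R.
Proof.
  intros Hi H. apply Cexp_minus_1_lower; [| exact Hi].
  assert (H1 : (Rabs (exp (Re h) - 1) <= 1 / 2)%R).
  { apply Rle_trans with (2 := H).
    rewrite <- (Rabs_pos_eq (Cmod _)) by apply Cmod_ge_0.
    apply Rsqr_le_abs_0. rewrite !Rsqr_pow2, Cmod_Cexp_minus_1.
    pose proof (exp_pos (Re h)). pose proof (pow2_ge_0 (sin (Im h / 2))). nra. }
  apply Rabs_le_between in H1. apply Rabs_le_between.
  pose proof (exp_minus_1_bounds (Re h)). nra.
Qed.

(** The principal logarithm on the half-plane Re u > 0; for Re u < 0 the angle is off by PI. *)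
Definition Clog (u : C) : C := (ln (Cmod u), atan (Im u / Re u)).

Lemma Cexp_Clog (u : C) : (0 < Re u)%R -> Cexp (Clog u) = u.
Proof.
  intros Hu. unfold Clog, Cexp; simpl.
  assert (Hm : (0 < Cmod u)%R).
  { apply Rlt_le_trans with (2 := re_le_Cmod u). rewrite Rabs_pos_eq; lra. }
  rewrite exp_ln by exact Hm. rewrite cos_atan, sin_atan.
  assert (Hs : (sqrt (1 + (Im u / Re u)²) = Cmod u / Re u)%R).
  { apply sqrt_lem_1.
    - pose proof (Rle_0_sqr (Im u / Re u)). lra.
    - apply Rlt_le, Rdiv_lt_0_compat; assumption.
    - unfold Rsqr. field_simplify_eq; [| lra]. rewrite Cmod2_alt. ring. }
  rewrite Hs. destruct u as [x y]; simpl in *. unfold RtoC, Cmult; simpl.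
  f_equal; field; lra.
Qed.

Lemma Clog_1 : Clog 1 = 0.
Proof.
  unfold Clog. rewrite Cmod_1, ln_1; simpl.
  unfold Rdiv. rewrite Rmult_0_l, atan_0. reflexivity.
Qed.

(** Multiplication by -1 = exp (i PI) or i = exp (i PI / 2) rotates z into the half-plane where
    [Clog] inverts exp. *)
Lemma Cexp_surj (z : C) : z <> 0 -> exists L : C, Cexp L = z.
Proof.
  intros Hz.
  assert (Hpi : Cexp (0, PI) = - (1)).
  { unfold Cexp, Cmult, Copp, RtoC; simpl. rewrite exp_0, cos_PI, sin_PI.
    f_equal; ring. }
  assert (Hpi2 : Cexp (0, PI / 2)%R = Ci).
  { unfold Cexp, Cmult, Ci, RtoC; simpl. rewrite exp_0, cos_PI2, sin_PI2.
    f_equal; ring. }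
  assert (Hp : forall w, (0 < Re w)%R -> exists L, Cexp L = w).
  { intros w Hw. exists (Clog w). apply Cexp_Clog, Hw. }
  assert (Hn : forall w, (exists L, Cexp L = - w) -> exists L, Cexp L = w).
  { intros w [L HL]. exists (L + (0, PI)%R). rewrite Cexp_plus, HL, Hpi. ring. }
  assert (Hi : forall w, (exists L, Cexp L = - (Ci * w)) -> exists L, Cexp L = w).
  { intros w [L HL]. exists (L + (0, PI / 2)%R). rewrite Cexp_plus, HL, Hpi2.
    destruct w; unfold Cmult, Copp, Ci; simpl. f_equal; ring. }
  destruct z as [x y].
  destruct (Rtotal_order x 0) as [h | [h | h]].
  - apply Hn, Hp. simpl. lra.
  - destruct (Rtotal_order y 0) as [h' | [h' | h']].
    + apply Hn, Hi, Hp. simpl. lra.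
    + exfalso. apply Hz. subst. reflexivity.
    + apply Hi, Hp. simpl. lra.
  - apply Hp. simpl. lra.
Qed.

(** * Complex derivatives of exp and of local logarithms *)

Lemma locally_C_Cmod (z : C) (P : C -> Prop) :
  locally (T := C_UniformSpace) z P <->
  exists d : posreal, forall w, (Cmod (w - z) < d)%R -> P w.
Proof.
  rewrite locally_C. split; intros [d Hd]; exists d; intros w Hw; apply Hd, Hw.
Qed.

Lemma locally_disk (w c : C) (r : R) :
  (Cmod (w - c) < r)%R ->
  locally (T := C_UniformSpace) w (fun w' => (Cmod (w' - c) < r)%R).
Proof.
  intros H. apply locally_C_Cmod.
  assert (Hd : (0 < r - Cmod (w - c))%R) by lra.
  exists (mkposreal _ Hd). simpl. intros w' Hw'.
  replace (w' - c) with ((w' - w) + (w - c)) by ring.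
  apply Rle_lt_trans with (1 := Cmod_triangle _ _). lra.
Qed.

(** Bridge from explicit second-order bounds to the abstract notion of derivative. *)
Lemma is_derive_C_quadratic (f : C -> C) (z l : C) (K d : R) :
  (0 < d)%R ->
  (forall w, (Cmod (w - z) < d)%R ->
     (Cmod (f w - f z - (w - z) * l) <= K * Cmod (w - z) ^ 2)%R) ->
  is_derive (K := C_AbsRing) (V := C_NormedModule) f z l.
Proof.
  intros Hd H. split.
  { apply is_linear_scal_l. }
  intros x Hx.
  rewrite <- (is_filter_lim_locally_unique (V := AbsRing_NormedModule C_AbsRing) z x Hx).
  intros eps.
  assert (Hm : (0 < Rmin d (eps / (Rabs K + 1)))%R).
  { apply Rmin_pos; [exact Hd |].
    apply Rdiv_lt_0_compat; [apply cond_pos |]. pose proof (Rabs_pos K). lra. }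
  exists (mkposreal _ Hm). intros w Hw.
  change (Cmod (w - z) < Rmin d (eps / (Rabs K + 1)))%R in Hw.
  change (Cmod (f w - f z - (w - z) * l) <= eps * Cmod (w - z))%R.
  apply Rle_trans with (1 := H w (Rlt_le_trans _ _ _ Hw (Rmin_l _ _))).
  pose proof (Cmod_ge_0 (w - z)) as H0. pose proof (Rabs_pos K) as H1.
  pose proof (Rle_abs K) as H2.
  assert (H3 : (Cmod (w - z) * (Rabs K + 1) <= eps)%R).
  { apply (Rmult_le_reg_r (/ (Rabs K + 1))).
    - apply Rinv_0_lt_compat; lra.
    - rewrite Rmult_assoc, Rinv_r, Rmult_1_r by lra.
      apply Rlt_le, Rlt_le_trans with (1 := Hw), Rmin_r. }
  apply Rle_trans with ((Cmod (w - z) * (Rabs K + 1)) * Cmod (w - z))%R; nra.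
Qed.

Lemma ex_derive_C_continuous (f : C -> C) (z : C) :
  ex_derive (K := C_AbsRing) (V := C_NormedModule) f z ->
  forall eps : posreal, locally (T := C_UniformSpace) z
    (fun w => (Cmod (f w - f z) < eps)%R).
Proof.
  intros H eps. apply ex_derive_continuous in H. apply locally_C.
  apply (H (fun y => (Cmod (y - f z) < eps)%R)).
  apply locally_C_Cmod. exists eps. intros w Hw. exact Hw.
Qed.

Lemma is_derive_fexp (lambda z : C) :
  is_derive (K := C_AbsRing) (V := C_NormedModule)
    (fexp lambda) z (lambda * fexp lambda z).
Proof.
  apply is_derive_C_quadratic
    with (K := (5 * Cmod (fexp lambda z) * Cmod lambda ^ 2)%R)
         (d := (/ (Cmod lambda + 1))%R).
  { apply Rinv_0_lt_compat. pose proof (Cmod_ge_0 lambda). lra. }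
  intros w Hw. pose proof (Cmod_ge_0 lambda) as H0. pose proof (Cmod_ge_0 (w - z)) as H1.
  assert (Hh : (Cmod (lambda * (w - z)) <= 1)%R).
  { rewrite Cmod_mult.
    apply Rle_trans with ((Cmod lambda + 1) * / (Cmod lambda + 1))%R.
    - apply Rmult_le_compat; lra.
    - rewrite Rinv_r; lra. }
  replace (fexp lambda w - fexp lambda z - (w - z) * (lambda * fexp lambda z))
    with (fexp lambda z * (Cexp (lambda * (w - z)) - 1 - lambda * (w - z))).
  - rewrite Cmod_mult. rewrite !Rmult_assoc, (Rmult_comm 5), !Rmult_assoc.
    apply Rmult_le_compat_l; [apply Cmod_ge_0 |].
    apply Rle_trans with (1 := Cexp_taylor_1 _ Hh). rewrite Cmod_mult. right. ring.
  - unfold fexp. replace (lambda * w) with (lambda * z + lambda * (w - z)) by ring.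
    rewrite (Cexp_plus (lambda * z)). ring.
Qed.

Lemma one_le_3PI2 : (1 <= 3 * PI / 2)%R.
Proof. pose proof PI2_1. lra. Qed.

(** The Taylor remainder of exp is quadratic in g w - g z, and the lower bound on exp - 1 gives |g w
    - g z| <= 12 |w - z| / |z|; so the remainder is quadratic in w - z. *)
Lemma is_derive_local_log (g : C -> C) (z : C) :
  z <> 0 ->
  locally (T := C_UniformSpace) z (fun w => Cexp (g w) = w) ->
  locally (T := C_UniformSpace) z (fun w => (Cmod (g w - g z) < 1)%R) ->
  is_derive (K := C_AbsRing) (V := C_NormedModule) g z (/ z).
Proof.
  intros Hz H1 H2. apply locally_C_Cmod in H1, H2.
  destruct H1 as [d1 H1], H2 as [d2 H2].
  assert (Hz' : (0 < Cmod z)%R) by (apply Cmod_gt_0, Hz).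
  apply is_derive_C_quadratic with (K := (5 * (12 / Cmod z) ^ 2)%R) (d := Rmin d1 d2).
  { apply Rmin_pos; apply cond_pos. }
  intros w Hw.
  pose proof (Rlt_le _ _ (H2 w (Rlt_le_trans _ _ _ Hw (Rmin_r _ _)))) as Hh.
  assert (He : Cexp (g w - g z) - 1 = (w - z) * / z).
  { rewrite Cexp_minus, !H1.
    - field. exact Hz.
    - replace (z - z) with (RtoC 0) by ring. rewrite Cmod_0. apply cond_pos.
    - apply Rlt_le_trans with (1 := Hw), Rmin_l. }
  replace (g w - g z - (w - z) * / z) with (- (Cexp (g w - g z) - 1 - (g w - g z)))
    by (rewrite He; ring).
  rewrite Cmod_opp. apply Rle_trans with (1 := Cexp_taylor_1 _ Hh).
  pose proof one_le_3PI2.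
  assert (Hl : (Cmod (g w - g z) / 12 <= Cmod (Cexp (g w - g z) - 1))%R).
  { apply Cexp_minus_1_lower.
    - apply Rle_trans with (1 := re_le_Cmod _). exact Hh.
    - apply Rle_trans with (1 := im_le_Cmod _). lra. }
  rewrite He, Cmod_mult, Cmod_inv in Hl by exact Hz.
  rewrite Rmult_assoc. apply Rmult_le_compat_l; [lra |].
  rewrite <- Rpow_mult_distr. apply pow_incr. split; [apply Cmod_ge_0 |].
  unfold Rdiv in *. lra.
Qed.

Section Branches.

Variables (lambda z L : C).
Hypothesis lambda_neq0 : lambda <> 0.
Hypothesis z_neq0 : z <> 0.
Hypothesis Cexp_L : Cexp L = z.

(** Division by z moves the center to 1, so that for w in the disk |w - z| < |z| the quotient stays
    in the half-plane where [Clog] is a logarithm. *)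
Definition log_branch (k : Z) (w : C) : C := L + Clog (w / z) + period k.

Definition fexp_branch (k : Z) (w : C) : C := log_branch k w / lambda.

Lemma fexp_branch_center (k : Z) : fexp_branch k z = (L + period k) / lambda.
Proof.
  unfold fexp_branch, log_branch. replace (z / z) with (RtoC 1) by (field; exact z_neq0).
  rewrite Clog_1. f_equal. ring.
Qed.

Lemma Cexp_log_branch (k : Z) (w : C) :
  (Cmod (w - z) < Cmod z)%R -> Cexp (log_branch k w) = w.
Proof.
  intros Hw. unfold log_branch. rewrite !Cexp_plus, Cexp_L, Cexp_period, Cexp_Clog.
  { field. exact z_neq0. }
  assert (Hz : (0 < Cmod z)%R) by (apply Cmod_gt_0, z_neq0).
  assert (H : (Cmod (w / z - 1) < 1)%R).
  { replace (w / z - 1) with ((w - z) / z) by (field; exact z_neq0).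
    rewrite Cmod_div by exact z_neq0. apply (Rmult_lt_reg_r (Cmod z)); [exact Hz |].
    unfold Rdiv. rewrite Rmult_assoc, Rinv_l; lra. }
  pose proof (re_le_Cmod (w / z - 1)) as H1.
  assert (H2 : (Rabs (Re (w / z) - 1) < 1)%R).
  { unfold Cminus in H1. rewrite re_plus, re_opp, re_RtoC in H1.
    unfold Cminus, Rminus in *. lra. }
  apply Rabs_def2 in H2. lra.
Qed.

Lemma disk_neq0 (w : C) : (Cmod (w - z) < Cmod z)%R -> w <> 0.
Proof.
  intros Hw ->. apply (Rlt_irrefl (Cmod z)). replace (0 - z) with (- z) in Hw by ring.
  rewrite Cmod_opp in Hw. exact Hw.
Qed.

(** The imaginary part of the increment is a difference of two arctangents, hence below PI in
    absolute value; in that strip a small exp - 1 forces a small increment. *)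
Lemma log_branch_continuous (k : Z) (w : C) :
  (Cmod (w - z) < Cmod z)%R ->
  locally (T := C_UniformSpace) w
    (fun w' => (Cmod (log_branch k w' - log_branch k w) < 1)%R).
Proof.
  intros Hw. apply locally_C_Cmod.
  pose proof (disk_neq0 w Hw) as Hw0.
  assert (Hw1 : (0 < Cmod w)%R) by (apply Cmod_gt_0, Hw0).
  (* The first bound keeps w' in the disk around z; in the second, 13 > 12 makes the increment
     smaller than 12/13. *)
  assert (Hd : (0 < Rmin (Cmod z - Cmod (w - z)) (Cmod w / 13))%R)
    by (apply Rmin_pos; lra).
  exists (mkposreal _ Hd). intros w' Hw'. simpl in Hw'.
  assert (He : Cexp (log_branch k w' - log_branch k w) - 1 = (w' - w) / w).
  { rewrite Cexp_minus, !Cexp_log_branch.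
    - field. exact Hw0.
    - exact Hw.
    - replace (w' - z) with ((w' - w) + (w - z)) by ring.
      apply Rle_lt_trans with (1 := Cmod_triangle _ _).
      pose proof (Rlt_le_trans _ _ _ Hw' (Rmin_l _ _)). lra. }
  assert (Hs : (Cmod ((w' - w) / w) < / 13)%R).
  { rewrite Cmod_div by exact Hw0. apply (Rmult_lt_reg_r (Cmod w)); [exact Hw1 |].
    unfold Rdiv at 1. rewrite Rmult_assoc, Rinv_l by lra.
    pose proof (Rlt_le_trans _ _ _ Hw' (Rmin_r _ _)). lra. }
  rewrite <- He in Hs.
  assert (Hl : (Cmod (log_branch k w' - log_branch k w) / 12
                <= Cmod (Cexp (log_branch k w' - log_branch k w) - 1))%R).
  { apply Cexp_minus_1_lower_strip; [| lra].
    replace (Im (log_branch k w' - log_branch k w))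
      with (atan (Im (w' / z) / Re (w' / z)) - atan (Im (w / z) / Re (w / z)))%R
      by (unfold log_branch, Clog; simpl; ring).
    pose proof (atan_bound (Im (w' / z) / Re (w' / z))).
    pose proof (atan_bound (Im (w / z) / Re (w / z))).
    apply Rabs_le_between. lra. }
  lra.
Qed.

Lemma center_in_disk : (Cmod (z - z) < Cmod z)%R.
Proof.
  replace (z - z) with (RtoC 0) by ring. rewrite Cmod_0. apply Cmod_gt_0, z_neq0.
Qed.

Lemma is_derive_fexp_branch (k : Z) (w : C) :
  (Cmod (w - z) < Cmod z)%R ->
  is_derive (K := C_AbsRing) (V := C_NormedModule) (fexp_branch k) w (/ (lambda * w)).
Proof.
  intros Hw.
  assert (Hd : is_derive (K := C_AbsRing) (V := C_NormedModule) (log_branch k) w (/ w)).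
  { apply is_derive_local_log.
    - apply disk_neq0, Hw.
    - generalize (locally_disk w z (Cmod z) Hw). apply filter_imp.
      intros w' Hw'. apply Cexp_log_branch, Hw'.
    - apply log_branch_continuous, Hw. }
  apply (is_derive_ext (fun w => / lambda * log_branch k w)).
  { intros t. apply Cmult_comm. }
  apply (filterdiff_ext_lin (U := AbsRing_NormedModule C_AbsRing) (V := C_NormedModule)
    _ (fun y : C => / lambda * (y * / w))).
  - exact (filterdiff_scal_r_fct (U := AbsRing_NormedModule C_AbsRing)
      (V := C_NormedModule) (/ lambda) _ _ Cmult_comm Hd).
  - intros y. change (/ lambda * (y * / w) = y * / (lambda * w)).
    field. split; [apply disk_neq0, Hw | exact lambda_neq0].
Qed.

Lemma inverse_branch_fexp_branch (k : Z) :
  inverse_branch (fexp lambda) z (fexp_branch k).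
Proof.
  unfold inverse_branch, holomorphic_at.
  split; generalize (locally_disk z z (Cmod z) center_in_disk); apply filter_imp; intros w Hw.
  - unfold fexp, fexp_branch.
    replace (lambda * (log_branch k w / lambda)) with (log_branch k w)
      by (field; exact lambda_neq0).
    apply Cexp_log_branch, Hw.
  - eexists. apply is_derive_fexp_branch, Hw.
Qed.

(** The value eta z fixes k. By continuity both functions stay so close to that common value that h,
    lambda times their difference, satisfies |h| <= 1; as exp h = 1, the lower bound on exp - 1
    leaves only h = 0. *)
Lemma inverse_branch_fexp_inv (eta : C -> C) :
  inverse_branch (fexp lambda) z eta ->
  exists k : Z, locally (T := C_UniformSpace) z (fun w => eta w = fexp_branch k w).
Proof.
  intros [He Hd].
  assert (H0 : Cexp (lambda * eta z - L) = 1).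
  { rewrite Cexp_minus, Cexp_L. apply locally_singleton in He. unfold fexp in He.
    rewrite He. field. exact z_neq0. }
  destruct (Cexp_eq_1 _ H0) as [k Hk]. exists k.
  assert (Hz : fexp_branch k z = eta z).
  { rewrite fexp_branch_center, <- Hk. field. exact lambda_neq0. }
  pose proof (Cmod_ge_0 lambda) as Hl.
  assert (Heps : (0 < / (2 * (Cmod lambda + 1)))%R) by (apply Rinv_0_lt_compat; lra).
  pose proof (ex_derive_C_continuous _ _ (locally_singleton _ _ Hd) (mkposreal _ Heps)) as C1.
  pose proof (ex_derive_C_continuous _ _
    (locally_singleton _ _ (proj2 (inverse_branch_fexp_branch k))) (mkposreal _ Heps)) as C2.
  generalize (filter_and _ _ (filter_and _ _ C1 C2)
    (filter_and _ _ He (locally_disk z z (Cmod z) center_in_disk))).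
  apply filter_imp. clear C1 C2. intros w [[C1 C2] [He' Hw]]. simpl in C1, C2.
  set (h := lambda * (eta w - fexp_branch k w)).
  assert (Hh : (Cmod h <= 1)%R).
  { unfold h. rewrite Cmod_mult.
    replace (eta w - fexp_branch k w)
      with ((eta w - eta z) + - (fexp_branch k w - fexp_branch k z))
      by (rewrite Hz; ring).
    apply Rle_trans with ((Cmod lambda + 1) *
      (/ (2 * (Cmod lambda + 1)) + / (2 * (Cmod lambda + 1))))%R.
    - apply Rmult_le_compat; [lra | apply Cmod_ge_0 | lra |].
      apply Rle_trans with (1 := Cmod_triangle _ _). rewrite Cmod_opp. lra.
    - right. field. lra. }
  assert (E : Cexp h - 1 = 0).
  { unfold h. replace (lambda * (eta w - fexp_branch k w))
      with (lambda * eta w - log_branch k w) by (unfold fexp_branch; field; exact lambda_neq0).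
    rewrite Cexp_minus, (Cexp_log_branch k w Hw). unfold fexp in He'. rewrite He'.
    field. apply disk_neq0, Hw. }
  assert (Hb : (Cmod h / 12 <= Cmod (Cexp h - 1))%R).
  { pose proof one_le_3PI2. apply Cexp_minus_1_lower.
    - apply Rle_trans with (1 := re_le_Cmod _). exact Hh.
    - apply Rle_trans with (1 := im_le_Cmod _). lra. }
  rewrite E, Cmod_0 in Hb.
  assert (Hh0 : h = 0).
  { apply Cmod_eq_0. pose proof (Cmod_ge_0 h). lra. }
  apply Ceq_minus. replace (eta w - fexp_branch k w) with (h / lambda)
    by (unfold h; field; exact lambda_neq0).
  rewrite Hh0. field. exact lambda_neq0.
Qed.

Lemma germ_eq (xi eta : C -> C) :
  locally (T := C_UniformSpace) z (fun w => eta w = xi w) -> germ z eta = germ z xi.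
Proof.
  intros H. apply functional_extensionality. intros f. apply propositional_extensionality.
  unfold germ. split; intros H'; generalize (filter_and _ _ H H'); apply filter_imp;
    intros w [H0 H1]; congruence.
Qed.

Lemma branch_germ_fexp (G : (C -> C) -> Prop) :
  branch_germ (fexp lambda) z G <-> exists k : Z, G = germ z (fexp_branch k).
Proof.
  split.
  - intros [eta [H ->]]. destruct (inverse_branch_fexp_inv eta H) as [k Hk].
    exists k. apply germ_eq, Hk.
  - intros [k ->]. exists (fexp_branch k). split; [| reflexivity].
    apply inverse_branch_fexp_branch.
Qed.

Lemma germ_fexp_branch_inj (j k : Z) :
  germ z (fexp_branch j) = germ z (fexp_branch k) -> j = k.
Proof.
  intros H.
  assert (H1 : germ z (fexp_branch k) (fexp_branch j)).
  { rewrite <- H. unfold germ. apply filter_forall. reflexivity. }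
  unfold germ in H1.
  apply locally_singleton in H1. rewrite !fexp_branch_center in H1.
  assert (H2 : period j = period k).
  { replace (period j) with ((L + period j) / lambda * lambda - L) by (field; exact lambda_neq0).
    rewrite H1. field. exact lambda_neq0. }
  unfold period in H2. injection H2 as H3. apply eq_IZR. pose proof PI_RGT_0.
  apply Rmult_eq_reg_l in H3; lra.
Qed.

(** The representative chosen by [epsilon] is unknown, but it agrees with [fexp_branch k] near z,
    hence has the same value and derivative there. *)
Lemma ruelle_term_fexp_branch (phi : C -> C) (k : Z) :
  ruelle_term phi z (germ z (fexp_branch k)) =
  phi ((L + period k) / lambda) * (/ (lambda * z)) ^ 2.
Proof.
  unfold ruelle_term.
  assert (H : germ z (fexp_branch k) (germ_repr (germ z (fexp_branch k)))).
  { unfold germ_repr. apply epsilon_spec. exists (fexp_branch k).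
    unfold germ. apply filter_forall. reflexivity. }
  set (eta := germ_repr _) in *. unfold germ in H.
  rewrite (locally_singleton _ _ H), fexp_branch_center.
  rewrite (is_C_derive_unique eta z (/ (lambda * z))); [reflexivity |].
  apply is_derive_ext_loc with (fexp_branch k).
  - apply locally_C. generalize H. apply filter_imp. congruence.
  - apply is_derive_fexp_branch, center_in_disk.
Qed.

End Branches.

(** * Unordered sums *)

Section FiniteSums.

Context {T : Type}.

Lemma list_sum_app (u : T -> C) (F G : list T) :
  list_sum u (F ++ G) = list_sum u F + list_sum u G.
Proof.
  induction F as [| a F IH]; simpl; [ring |].
  fold (list_sum u (F ++ G)). fold (list_sum u F). rewrite IH. ring.
Qed.

Lemma list_sum_map {I : Type} (f : I -> T) (u : T -> C) (F : list I) :
  list_sum u (map f F) = list_sum (fun i => u (f i)) F.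
Proof. induction F as [| a F IH]; simpl; [reflexivity |]. f_equal. exact IH. Qed.

Lemma list_sum_ext_in (u v : T -> C) (F : list T) :
  (forall k, In k F -> u k = v k) -> list_sum u F = list_sum v F.
Proof.
  induction F as [| a F IH]; intros H; simpl; [reflexivity |].
  f_equal; [apply H; now left |]. apply IH. intros k Hk. apply H. now right.
Qed.

Lemma list_sum_perm (u : T -> C) (F G : list T) :
  Permutation F G -> list_sum u F = list_sum u G.
Proof.
  induction 1; unfold list_sum in *; simpl; [reflexivity | congruence | ring | congruence].
Qed.

Lemma list_sum_plus (u v : T -> C) (F : list T) :
  list_sum (fun k => u k + v k) F = list_sum u F + list_sum v F.
Proof.
  induction F as [| a F IH]; unfold list_sum in *; simpl; [ring |]. rewrite IH. ring.
Qed.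

Lemma list_sum_scal (c : C) (u : T -> C) (F : list T) :
  list_sum (fun k => c * u k) F = c * list_sum u F.
Proof.
  induction F as [| a F IH]; unfold list_sum in *; simpl; [ring |]. rewrite IH. ring.
Qed.

Definition Rlist_sum (b : T -> R) (F : list T) : R :=
  fold_right (fun k s => b k + s)%R 0%R F.

Lemma Cmod_list_sum_le (u : T -> C) (b : T -> R) (F : list T) :
  (forall k, In k F -> (Cmod (u k) <= b k)%R) ->
  (Cmod (list_sum u F) <= Rlist_sum b F)%R.
Proof.
  induction F as [| a F IH]; intros H; simpl.
  - rewrite Cmod_0. lra.
  - apply Rle_trans with (1 := Cmod_triangle _ _). apply Rplus_le_compat.
    + apply H. now left.
    + apply IH. intros k Hk. apply H. now right.
Qed.

Lemma Rlist_sum_app (b : T -> R) (F G : list T) :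
  Rlist_sum b (F ++ G) = (Rlist_sum b F + Rlist_sum b G)%R.
Proof.
  induction F as [| a F IH]; unfold Rlist_sum in *; simpl; [ring |]. rewrite IH. ring.
Qed.

Lemma Rlist_sum_scal (c : R) (b : T -> R) (F : list T) :
  Rlist_sum (fun k => c * b k)%R F = (c * Rlist_sum b F)%R.
Proof.
  induction F as [| a F IH]; unfold Rlist_sum in *; simpl; [ring |]. rewrite IH. ring.
Qed.

Lemma Rlist_sum_incl (b : T -> R) (F G : list T) :
  (forall k, (0 <= b k)%R) -> NoDup F -> incl F G -> (Rlist_sum b F <= Rlist_sum b G)%R.
Proof.
  intros Hb. revert G. induction F as [| a F IH]; intros G HF HG.
  - clear HG. induction G as [| c G IHG]; simpl; [lra |].
    specialize (Hb c). simpl in IHG. fold (Rlist_sum b G). lra.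
  - destruct (in_split a G (HG a (or_introl eq_refl))) as [G1 [G2 ->]].
    inversion HF as [| ? ? Ha HF']; subst.
    rewrite Rlist_sum_app. simpl. fold (Rlist_sum b F). fold (Rlist_sum b G2).
    assert (H : (Rlist_sum b F <= Rlist_sum b (G1 ++ G2))%R).
    { apply IH; [exact HF' |]. intros k Hk.
      assert (Hk' := HG k (or_intror Hk)). apply in_app_iff in Hk'.
      apply in_app_iff. destruct Hk' as [| [-> |]]; tauto. }
    rewrite Rlist_sum_app in H. lra.
Qed.

(** Splits a finite set into a core F and a remainder. Membership is decided classically, since
    equality on T (germs, for instance) need not be decidable. *)
Lemma list_sum_NoDup_split (u : T -> C) (F G : list T) :
  NoDup F -> NoDup G -> incl F G ->
  exists F', NoDup F' /\ (forall k, In k F' -> In k G /\ ~ In k F) /\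
    list_sum u G = list_sum u F + list_sum u F'.
Proof.
  intros HF HG Hi.
  set (p := fun k => if excluded_middle_informative (In k F) then false else true).
  assert (Hp : forall k, In k (filter p G) <-> In k G /\ ~ In k F).
  { intros k. rewrite filter_In. unfold p.
    destruct excluded_middle_informative; intuition discriminate. }
  exists (filter p G). split; [apply NoDup_filter, HG |]. split.
  { intros k. apply Hp. }
  rewrite <- list_sum_app. apply list_sum_perm, NoDup_Permutation; [exact HG | |].
  - apply NoDup_app; [exact HF | apply NoDup_filter, HG |].
    intros k H1 H2. apply Hp in H2. tauto.
  - intros k. rewrite in_app_iff, Hp. specialize (Hi k). tauto.
Qed.

Lemma is_unordered_sum_plus (A : T -> Prop) (u v : T -> C) (s t : C) :
  is_unordered_sum A u s -> is_unordered_sum A v t ->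
  is_unordered_sum A (fun k => u k + v k) (s + t).
Proof.
  intros Hu Hv eps.
  destruct (Hu (pos_div_2 eps)) as [F1 [H1 H1']].
  destruct (Hv (pos_div_2 eps)) as [F2 [H2 H2']].
  exists (F1 ++ F2). split; [apply Forall_app; auto |].
  intros F HF HA Hi. apply incl_app_inv in Hi. destruct Hi as [Hi1 Hi2].
  rewrite list_sum_plus.
  replace (list_sum u F + list_sum v F - (s + t))
    with ((list_sum u F - s) + (list_sum v F - t)) by ring.
  apply Rle_lt_trans with (1 := Cmod_triangle _ _).
  specialize (H1' F HF HA Hi1). specialize (H2' F HF HA Hi2). simpl in *. lra.
Qed.

Lemma is_unordered_sum_scal (A : T -> Prop) (c : C) (u : T -> C) (s : C) :
  is_unordered_sum A u s -> is_unordered_sum A (fun k => c * u k) (c * s).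
Proof.
  intros Hu eps. pose proof (Cmod_ge_0 c) as Hc.
  (* The + 1 keeps the divisor positive when c = 0. *)
  assert (He : (0 < eps / (Cmod c + 1))%R).
  { apply Rdiv_lt_0_compat; [apply cond_pos | lra]. }
  destruct (Hu (mkposreal _ He)) as [F0 [H0 H0']]. exists F0. split; [exact H0 |].
  intros F HF HA Hi. specialize (H0' F HF HA Hi). simpl in H0'.
  rewrite list_sum_scal. replace (c * list_sum u F - c * s) with (c * (list_sum u F - s)) by ring.
  rewrite Cmod_mult. pose proof (Cmod_ge_0 (list_sum u F - s)) as Hs.
  apply Rle_lt_trans with ((Cmod c + 1) * Cmod (list_sum u F - s))%R; [nra |].
  apply Rlt_le_trans with ((Cmod c + 1) * (eps / (Cmod c + 1)))%R.
  - apply Rmult_lt_compat_l; lra.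
  - right. field. lra.
Qed.

Lemma is_unordered_sum_ext (A : T -> Prop) (u v : T -> C) (s : C) :
  (forall k, u k = v k) -> is_unordered_sum A u s -> is_unordered_sum A v s.
Proof. intros H. replace v with u; [auto |]. apply functional_extensionality, H. Qed.

(** The sum over the union of both finite sets would be closer than |s - t| / 2 to s and to t. *)
Lemma is_unordered_sum_unique (A : T -> Prop) (u : T -> C) (s t : C) :
  is_unordered_sum A u s -> is_unordered_sum A u t -> s = t.
Proof.
  intros Hs Ht. apply NNPP. intros Hne.
  assert (Hd : (0 < Cmod (s - t) / 2)%R).
  { assert (0 < Cmod (s - t))%R by (apply Cmod_gt_0, Cminus_eq_contra, Hne). lra. }
  destruct (Hs (mkposreal _ Hd)) as [F1 [H1 H1']].
  destruct (Ht (mkposreal _ Hd)) as [F2 [H2 H2']].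
  set (F := nodup (fun x y => excluded_middle_informative (x = y)) (F1 ++ F2)).
  assert (HF : NoDup F) by apply NoDup_nodup.
  assert (HA : List.Forall A F).
  { apply Forall_forall. intros k Hk. apply nodup_In in Hk.
    revert k Hk. apply Forall_forall, Forall_app. auto. }
  assert (Hi : incl (F1 ++ F2) F) by (intros k Hk; apply nodup_In, Hk).
  apply incl_app_inv in Hi. destruct Hi as [Hi1 Hi2].
  specialize (H1' F HF HA Hi1). specialize (H2' F HF HA Hi2). simpl in *.
  assert (H : (Cmod (s - t) <= Cmod (list_sum u F - t) + Cmod (list_sum u F - s))%R).
  { rewrite <- (Cmod_opp (list_sum u F - s)).
    replace (s - t) with ((list_sum u F - t) + - (list_sum u F - s)) by ring.
    apply Cmod_triangle. }
  lra.
Qed.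

(** Turns the sum over germs of branches into a sum over the integers labelling them. *)
Lemma is_unordered_sum_reindex {I : Type} (A : T -> Prop) (u : T -> C) (f : I -> T) (s : C) :
  (forall i j, f i = f j -> i = j) -> (forall k, A k <-> exists i, k = f i) ->
  is_unordered_sum (fun _ => True) (fun i => u (f i)) s -> is_unordered_sum A u s.
Proof.
  intros Hf HA Hs eps. destruct (Hs eps) as [F0 [_ H0]]. exists (map f F0). split.
  { apply Forall_forall. intros k Hk. apply in_map_iff in Hk.
    destruct Hk as [i [<- _]]. apply HA. now exists i. }
  intros F HF HFA Hi.
  assert (HG : exists G, F = map f G).
  { clear HF Hi. induction HFA as [| k F Hk _ [G ->]]; [now exists nil |].
    apply HA in Hk. destruct Hk as [i ->]. now exists (i :: G). }
  destruct HG as [G ->]. rewrite list_sum_map. apply H0.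
  - apply NoDup_map_inv with (1 := HF).
  - apply Forall_forall. auto.
  - intros i Hi'. assert (H := Hi (f i) (in_map f _ _ Hi')).
    apply in_map_iff in H. destruct H as [j [Hj Hj']]. apply Hf in Hj. congruence.
Qed.

Lemma list_sum_cvg (u : T -> C) (v : nat -> T -> C) :
  (forall k eps, (0 < eps)%R ->
     exists n0, forall n, (n0 <= n)%nat -> (Cmod (v n k - u k) < eps)%R) ->
  forall (F : list T) eps, (0 < eps)%R ->
     exists n0, forall n, (n0 <= n)%nat ->
       (Cmod (list_sum (v n) F - list_sum u F) < eps)%R.
Proof.
  intros H F. induction F as [| a F IH]; intros eps Heps.
  - exists 0%nat. intros n _. simpl. replace (0 - 0) with (RtoC 0) by ring.
    rewrite Cmod_0. exact Heps.
  - assert (He : (0 < eps / 2)%R) by lra.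
    destruct (H a _ He) as [n1 H1]. destruct (IH _ He) as [n2 H2].
    exists (n1 + n2)%nat. intros n Hn. specialize (H1 n ltac:(lia)). specialize (H2 n ltac:(lia)).
    simpl. fold (list_sum (v n) F). fold (list_sum u F).
    replace (v n a + list_sum (v n) F - (u a + list_sum u F))
      with ((v n a - u a) + (list_sum (v n) F - list_sum u F)) by ring.
    apply Rle_lt_trans with (1 := Cmod_triangle _ _). lra.
Qed.

Lemma eventually_incl (W : nat -> list T) :
  (forall k, exists n0, forall n, (n0 <= n)%nat -> In k (W n)) ->
  forall F : list T, exists n0, forall n, (n0 <= n)%nat -> incl F (W n).
Proof.
  intros H F. induction F as [| a F [n2 H2]].
  - exists 0%nat. intros n _ k [].
  - destruct (H a) as [n1 H1]. exists (n1 + n2)%nat. intros n Hn.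
    apply incl_cons; [apply H1 | apply H2]; lia.
Qed.

(* Tannery's theorem (dominated convergence for sums). *)
Lemma unordered_sum_dominated (u : T -> C) (v : nat -> T -> C) (W : nat -> list T)
    (b : T -> R) (F1 : list T) (n1 : nat) (c : C) :
  (forall eps, (0 < eps)%R -> exists F0 : list T, forall F, NoDup F ->
     (forall k, In k F -> ~ In k F0) -> (Rlist_sum b F <= eps)%R) ->
  (forall k, ~ In k F1 -> (Cmod (u k) <= b k)%R) ->
  (forall n k, (n1 <= n)%nat -> In k (W n) -> ~ In k F1 -> (Cmod (v n k) <= b k)%R) ->
  (forall k eps, (0 < eps)%R ->
     exists n0, forall n, (n0 <= n)%nat -> (Cmod (v n k - u k) < eps)%R) ->
  (forall k, exists n0, forall n, (n0 <= n)%nat -> In k (W n)) ->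
  (forall n, NoDup (W n)) ->
  (forall n, list_sum (v n) (W n) = c) ->
  is_unordered_sum (fun _ => True) u c.
Proof.
  intros Htail Hu Hv Hcvg HW HWnd Hc eps.
  (* Three errors of size eps / 4: the change of summand on the core [F2], and the remainders of u
     and of v n outside it. *)
  assert (He : (0 < eps / 4)%R) by (pose proof (cond_pos eps); lra).
  destruct (Htail _ He) as [F0 H0].
  (* Outside F0 the sums of b are small; on F1 the function b need not dominate. *)
  set (F2 := nodup (fun x y => excluded_middle_informative (x = y)) (F0 ++ F1)).
  assert (HF2 : NoDup F2) by apply NoDup_nodup.
  assert (Hin : forall k, In k F2 <-> In k F0 \/ In k F1).
  { intros k. unfold F2. rewrite nodup_In. apply in_app_iff. }
  exists F2. split; [apply Forall_forall; auto |].
  intros F HF _ Hi.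
  destruct (list_sum_NoDup_split u F2 F HF2 HF Hi) as [G1 [N1 [I1 E1]]].
  destruct (list_sum_cvg u v Hcvg F2 _ He) as [n2 H2].
  destruct (eventually_incl W HW F2) as [n3 H3].
  set (n := (n1 + n2 + n3)%nat).
  specialize (H2 n ltac:(lia)). specialize (H3 n ltac:(lia)).
  destruct (list_sum_NoDup_split (v n) F2 (W n) HF2 (HWnd n) H3) as [G2 [N2 [I2 E2]]].
  assert (B1 : (Cmod (list_sum u G1) <= eps / 4)%R).
  { apply Rle_trans with (Rlist_sum b G1).
    - apply Cmod_list_sum_le. intros k Hk. apply Hu. intros Hk'.
      apply (proj2 (I1 k Hk)), Hin. now right.
    - apply H0; [exact N1 |]. intros k Hk Hk'. apply (proj2 (I1 k Hk)), Hin. now left. }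
  assert (B2 : (Cmod (list_sum (v n) G2) <= eps / 4)%R).
  { apply Rle_trans with (Rlist_sum b G2).
    - apply Cmod_list_sum_le. intros k Hk. apply Hv; [lia | apply I2, Hk |]. intros Hk'.
      apply (proj2 (I2 k Hk)), Hin. now right.
    - apply H0; [exact N2 |]. intros k Hk Hk'. apply (proj2 (I2 k Hk)), Hin. now left. }
  (* Every windowed sum equals c, so comparing with a single large n is enough. *)
  rewrite E1, <- (Hc n), E2.
  replace (list_sum u F2 + list_sum u G1 - (list_sum (v n) F2 + list_sum (v n) G2))
    with (- (list_sum (v n) F2 - list_sum u F2) + (list_sum u G1 + - list_sum (v n) G2)) by ring.
  apply Rle_lt_trans with (1 := Cmod_triangle _ _). rewrite Cmod_opp.
  pose proof (Cmod_triangle (list_sum u G1) (- list_sum (v n) G2)) as H.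
  rewrite Cmod_opp in H. lra.
Qed.

End FiniteSums.

(** * Tails of the sum of inverse squares over the integers *)

(** Telescoping, from 1 / (K + 1)^2 <= 1 / K - 1 / (K + 1). The map f stands for n or - n, which
    covers both half-lines. *)
Lemma inv_sqr_tail_pos (K M : nat) (f : nat -> Z) :
  (1 <= K)%nat -> (forall n, Z.abs (f n) = Z.of_nat n) ->
  (Rlist_sum (fun k => / IZR k ^ 2) (map f (seq (S K) M)) <= / INR K - / INR (K + M))%R.
Proof.
  intros HK Hf. revert K HK. induction M as [| M IH]; intros K HK; simpl.
  - rewrite Nat.add_0_r. lra.
  - specialize (IH (S K) ltac:(lia)). replace (K + S M)%nat with (S K + M)%nat by lia.
    unfold Rlist_sum in IH.
    apply Rle_trans with (/ IZR (f (S K)) ^ 2 + (/ INR (S K) - / INR (S K + M)))%R.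
    { apply Rplus_le_compat_l, IH. }
    replace (IZR (f (S K)) ^ 2)%R with (INR (S K) ^ 2)%R.
    + assert (HK' : (1 <= INR K)%R) by (apply (le_INR 1), HK).
      assert (E : (/ INR (S K) ^ 2 <= / INR K - / INR (S K))%R).
      { rewrite S_INR. replace (/ INR K - / (INR K + 1))%R with (/ (INR K * (INR K + 1)))%R
          by (field; lra).
        apply Rinv_le_contravar; nra. }
      lra.
    + rewrite INR_IZR_INZ, <- Hf, abs_IZR, pow2_abs. reflexivity.
Qed.

(** 0 is listed twice; only membership matters. *)
Definition zball (K : nat) : list Z :=
  map Z.of_nat (seq 0 (S K)) ++ map (fun n => - Z.of_nat n)%Z (seq 0 (S K)).

Lemma in_zball (K : nat) (k : Z) : In k (zball K) <-> (Z.abs k <= Z.of_nat K)%Z.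
Proof.
  unfold zball. rewrite in_app_iff, !in_map_iff. split.
  - intros [[n [<- Hn]] | [n [<- Hn]]]; apply in_seq in Hn; lia.
  - intros H. destruct (Z.le_gt_cases 0 k) as [h | h]; [left | right];
      exists (Z.abs_nat k); (split; [lia | apply in_seq; lia]).
Qed.

Lemma inv_sqr_tail (C0 : R) :
  (0 <= C0)%R ->
  forall eps, (0 < eps)%R -> exists F0 : list Z, forall F, NoDup F ->
     (forall k, In k F -> ~ In k F0) -> (Rlist_sum (fun k => C0 * / IZR k ^ 2) F <= eps)%R.
Proof.
  intros HC eps Heps.
  (* Each half-line has tail at most 1 / K, hence the factor 2; the + 1 ensures K >= 1. *)
  destruct (INR_unbounded (2 * C0 / eps + 1)) as [K HK].
  assert (HK1 : (0 <= 2 * C0 / eps)%R) by (apply Rdiv_le_0_compat; lra).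
  assert (HK2 : (1 <= K)%nat) by (apply INR_le; simpl; lra).
  exists (zball K).
  intros F HF Hout.
  assert (Hlarge : forall k, In k F -> (Z.of_nat K < Z.abs k)%Z).
  { intros k Hk. apply Z.nle_gt. intros Hle. apply (Hout k Hk), in_zball, Hle. }
  assert (HM : exists M, forall k, In k F -> (Z.abs k <= Z.of_nat M)%Z).
  { clear. induction F as [| a F [M H]]; [exists 0%nat; intros k [] |].
    exists (M + Z.abs_nat a)%nat. intros k [<- | Hk]; [lia |]. specialize (H k Hk). lia. }
  destruct HM as [M HM].
  apply Rle_trans with (C0 * Rlist_sum (fun k => / IZR k ^ 2)
    (map Z.of_nat (seq (S K) M) ++ map (fun n => - Z.of_nat n)%Z (seq (S K) M)))%R.
  - apply Rle_trans with (C0 * Rlist_sum (fun k => / IZR k ^ 2) F)%R.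
    + right. apply Rlist_sum_scal.
    + apply Rmult_le_compat_l; [exact HC |]. apply Rlist_sum_incl; [| exact HF |].
      (* At k = 0 the term takes the default value / 0 = 0. *)
      * intros k. destruct (Z.eq_dec k 0) as [-> |].
        { replace (0 ^ 2)%R with 0%R by ring. rewrite Rinv_0. lra. }
        apply Rlt_le, Rinv_0_lt_compat, pow2_gt_0, not_0_IZR. assumption.
      * intros k Hk. specialize (Hlarge k Hk). specialize (HM k Hk). apply in_app_iff.
        destruct (Z.le_gt_cases 0 k) as [h | h]; [left | right]; apply in_map_iff;
          exists (Z.abs_nat k); (split; [lia | apply in_seq; lia]).
  - rewrite Rlist_sum_app.
    pose proof (inv_sqr_tail_pos K M Z.of_nat HK2 ltac:(intros; lia)) as T1.
    pose proof (inv_sqr_tail_pos K M (fun n => - Z.of_nat n)%Z HK2 ltac:(intros; lia)) as T2.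
    assert (HKM : (0 < / INR (K + M))%R) by (apply Rinv_0_lt_compat, lt_0_INR; lia).
    apply Rle_trans with (C0 * (2 * / INR K))%R; [apply Rmult_le_compat_l; lra |].
    apply (Rmult_le_reg_r (INR K)); [lra |].
    replace (C0 * (2 * / INR K) * INR K)%R with (2 * C0 / eps * eps)%R by (field; lra).
    rewrite Rmult_comm. apply Rmult_le_compat_l; lra.
Qed.

(** * Partial fractions of the cotangent *)

Lemma RtoC_neq (x y : R) : x <> y -> RtoC x <> RtoC y.
Proof. intros H E. apply H, RtoC_inj, E. Qed.

Lemma period_plus (j k : Z) : period (j + k) = period j + period k.
Proof. unfold period, Cplus; simpl. rewrite plus_IZR. f_equal; ring. Qed.

Lemma period_scal (j k : Z) : IZR j * period k = period (j * k).
Proof. unfold period, Cmult, RtoC; simpl. rewrite mult_IZR. f_equal; ring. Qed.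

Lemma Cmod_Cexp (s : C) : Cmod (Cexp s) = exp (Re s).
Proof.
  unfold Cexp. rewrite Cmod_mult, Cmod_R, Rabs_pos_eq by apply Rlt_le, exp_pos.
  assert (H : (Cmod (cos (Im s), sin (Im s)) = 1)%R).
  { unfold Cmod; simpl. rewrite !Rmult_1_r. rewrite Rplus_comm.
    fold (Rsqr (sin (Im s))). fold (Rsqr (cos (Im s))).
    rewrite sin2_cos2. apply sqrt_1. }
  rewrite H. ring.
Qed.

(** This is (coth (s / 2) - 1) / 2, with simple poles of residue 1 at the multiples of 2 pi i; the
    constant - 1/2 cancels in the differences that are summed. *)
Definition inv_exp1 (s : C) : C := / (Cexp s - 1).

Lemma Cexp_half_period (c : Z) : (c = 1 \/ c = -1)%Z -> Cexp (period c / 2) = - (1).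
Proof.
  intros Hc.
  assert (E : period c / 2 = (0, IZR c * PI)%R).
  { unfold period. replace (0, (2 * PI * IZR c)%R) with (2 * (0, (IZR c * PI)%R)).
    - field.
    - unfold Cmult, RtoC; simpl. f_equal; ring. }
  rewrite E. unfold Cexp, Cmult, Copp, RtoC; simpl. rewrite exp_0.
  destruct Hc as [-> | ->].
  - rewrite (Rmult_1_l PI), cos_PI, sin_PI. f_equal; ring.
  - replace (-1 * PI)%R with (- PI)%R by ring.
    rewrite cos_neg, sin_neg, cos_PI, sin_PI. f_equal; ring.
Qed.

(** Either shift by 2 pi i turns y = exp (s / 2) into - y. Both signs are used: upward shifts
    generate [residues], one downward shift centers [window]. *)
Lemma inv_exp1_duplication (s : C) (c : Z) :
  (c = 1 \/ c = -1)%Z -> Cexp s <> 1 ->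
  inv_exp1 s = / 2 * (inv_exp1 (s / 2) + inv_exp1 ((s + period c) / 2)).
Proof.
  intros Hc Hs.
  set (y := Cexp (s / 2)).
  assert (E1 : Cexp s = y * y).
  { unfold y. rewrite <- Cexp_plus. f_equal. field. }
  assert (E2 : Cexp ((s + period c) / 2) = - y).
  { replace ((s + period c) / 2) with (s / 2 + period c / 2) by field.
    rewrite Cexp_plus, (Cexp_half_period c Hc). unfold y. ring. }
  unfold inv_exp1. rewrite E2, E1. fold y. rewrite E1 in Hs.
  assert (y - 1 <> 0).
  { intros E. apply Hs. apply Ceq_minus.
    replace (y * y - 1) with ((y - 1) * (y + 1)) by ring. rewrite E. ring. }
  assert (y + 1 <> 0).
  { intros E. apply Hs. apply Ceq_minus.
    replace (y * y - 1) with ((y + 1) * (y - 1)) by ring. rewrite E. ring. }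
  assert (- y - 1 <> 0).
  { intros E. apply H0. replace (y + 1) with (- (- y - 1)) by ring. rewrite E. ring. }
  assert (y * y - 1 <> 0) by (apply Cminus_eq_contra; exact Hs).
  field. repeat split; assumption.
Qed.

Lemma Cexp_scaled_neq1 (s : C) (N k : Z) :
  (0 < N)%Z -> Cexp s <> 1 -> Cexp ((s + period k) / IZR N) <> 1.
Proof.
  intros HN Hs H. apply Cexp_eq_1 in H. destruct H as [j Hj]. apply Hs.
  assert (HN' : RtoC (IZR N) <> 0) by (apply RtoC_neq, not_0_IZR; lia).
  assert (E : s = period (N * j + - k)).
  { rewrite period_plus, <- period_scal, <- Hj.
    replace (period (- k)) with (- period k).
    - field. exact HN'.
    - unfold period, Copp; simpl. rewrite opp_IZR. f_equal; ring. }
  rewrite E. apply Cexp_period.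
Qed.

Lemma inv_exp1_duplication_sum (s : C) (N c : Z) (F : list Z) :
  (0 < N)%Z -> (c = 1 \/ c = -1)%Z -> Cexp s <> 1 ->
  list_sum (fun k => inv_exp1 ((s + period k) / IZR N)) F =
  / 2 * list_sum (fun k => inv_exp1 ((s + period k) / IZR (2 * N)))
          (F ++ map (fun k => k + c * N)%Z F).
Proof.
  intros HN Hc Hs.
  assert (HN' : RtoC (IZR N) <> 0) by (apply RtoC_neq, not_0_IZR; lia).
  rewrite list_sum_app, list_sum_map, <- list_sum_plus, <- list_sum_scal.
  apply list_sum_ext_in. intros k _.
  rewrite (inv_exp1_duplication _ c Hc (Cexp_scaled_neq1 s N k HN Hs)).
  rewrite mult_IZR, RtoC_mult.
  f_equal. f_equal; f_equal.
  - field. exact HN'.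
  - rewrite period_plus, Z.mul_comm, <- period_scal. field. exact HN'.
Qed.

(** Listed in the order in which iterated duplication produces the shifts; the factor 1 matches the
    sign c in [inv_exp1_duplication_sum]. *)
Fixpoint residues (m : nat) : list Z :=
  match m with
  | O => 0%Z :: nil
  | S m => residues m ++ map (fun k => k + 1 * 2 ^ Z.of_nat m)%Z (residues m)
  end.

(* The shift is downwards, so that [(s + period k) / mesh m] stays in the strip
   [|Im| <= 3 * PI / 2], where [exp - 1] vanishes only at 0. *)
Definition window (m : nat) : list Z :=
  residues m ++ map (fun k => k + -1 * 2 ^ Z.of_nat m)%Z (residues m).

Lemma in_residues (m : nat) (k : Z) :
  In k (residues m) <-> (0 <= k < 2 ^ Z.of_nat m)%Z.
Proof.
  revert k. induction m as [| m IH]; intros k.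
  - simpl. lia.
  - cbn [residues]. rewrite in_app_iff, in_map_iff, IH, Nat2Z.inj_succ, Z.pow_succ_r by lia.
    split.
    + intros [H | [j [<- H]]]; [lia |]. apply IH in H. lia.
    + intros H. destruct (Z.le_gt_cases (2 ^ Z.of_nat m) k) as [h | h]; [right | left; lia].
      exists (k - 2 ^ Z.of_nat m)%Z. split; [lia |]. apply IH. lia.
Qed.

Lemma in_window (m : nat) (k : Z) :
  In k (window m) <-> (- 2 ^ Z.of_nat m <= k < 2 ^ Z.of_nat m)%Z.
Proof.
  unfold window. rewrite in_app_iff, in_map_iff, in_residues. split.
  - intros [H | [j [<- H]]]; [lia |]. apply in_residues in H. lia.
  - intros H. destruct (Z.le_gt_cases 0 k) as [h | h]; [left; lia | right].
    exists (k + 2 ^ Z.of_nat m)%Z. split; [lia |]. apply in_residues. lia.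
Qed.

Lemma NoDup_residues (m : nat) : NoDup (residues m).
Proof.
  induction m as [| m IH]; cbn [residues].
  - constructor; [intros [] | constructor].
  - apply NoDup_app; [exact IH | |].
    + apply FinFun.Injective_map_NoDup; [| exact IH]. intros x y H. lia.
    + intros k H1 H2. apply in_residues in H1. apply in_map_iff in H2.
      destruct H2 as [j [<- H2]]. apply in_residues in H2. lia.
Qed.

Lemma NoDup_window (m : nat) : NoDup (window m).
Proof.
  apply NoDup_app; [apply NoDup_residues | |].
  - apply FinFun.Injective_map_NoDup; [| apply NoDup_residues]. intros x y H. lia.
  - intros k H1 H2. apply in_residues in H1. apply in_map_iff in H2.
    destruct H2 as [j [<- H2]]. apply in_residues in H2. lia.
Qed.

Lemma inv_exp1_residues (s : C) (m : nat) :
  Cexp s <> 1 ->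
  inv_exp1 s = / IZR (2 ^ Z.of_nat m) *
    list_sum (fun k => inv_exp1 ((s + period k) / IZR (2 ^ Z.of_nat m))) (residues m).
Proof.
  intros Hs. induction m as [| m IH].
  - simpl. replace (period 0) with (RtoC 0) by (unfold period, RtoC; f_equal; ring).
    replace ((s + 0) / 1) with s by field. field.
  - assert (HN : (0 < 2 ^ Z.of_nat m)%Z) by (apply Z.pow_pos_nonneg; lia).
    rewrite IH, (inv_exp1_duplication_sum s _ 1 _ HN (or_introl eq_refl) Hs).
    rewrite Nat2Z.inj_succ, Z.pow_succ_r by lia. cbn [residues].
    assert (HN' : RtoC (IZR (2 ^ Z.of_nat m)) <> 0) by (apply RtoC_neq, not_0_IZR; lia).
    rewrite Cmult_assoc. f_equal. rewrite mult_IZR, RtoC_mult. field. exact HN'.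
Qed.

(** The number of elements of [window m], and thus the N of the averaging identity. *)
Definition mesh (m : nat) : R := IZR (2 * 2 ^ Z.of_nat m).

Lemma inv_exp1_window (s : C) (m : nat) :
  Cexp s <> 1 ->
  inv_exp1 s = / mesh m *
    list_sum (fun k => inv_exp1 ((s + period k) / mesh m)) (window m).
Proof.
  intros Hs.
  assert (HN : (0 < 2 ^ Z.of_nat m)%Z) by (apply Z.pow_pos_nonneg; lia).
  assert (HN' : RtoC (IZR (2 ^ Z.of_nat m)) <> 0) by (apply RtoC_neq, not_0_IZR; lia).
  rewrite (inv_exp1_residues s m Hs),
    (inv_exp1_duplication_sum s _ (-1) _ HN (or_intror eq_refl) Hs).
  unfold mesh. rewrite Cmult_assoc. f_equal. rewrite mult_IZR, RtoC_mult.
  field. exact HN'.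
Qed.

Lemma mesh_lower (m : nat) : (INR m < mesh m)%R.
Proof.
  unfold mesh. rewrite INR_IZR_INZ. apply IZR_lt.
  pose proof (Z.pow_gt_lin_r 2 (Z.of_nat m)). lia.
Qed.

Lemma mesh_unbounded (B : R) : exists n0, forall n, (n0 <= n)%nat -> (B < mesh n)%R.
Proof.
  destruct (INR_unbounded B) as [n0 H0]. exists n0. intros n Hn.
  apply le_INR in Hn. pose proof (mesh_lower n). lra.
Qed.

Lemma mesh_pos (m : nat) : (0 < mesh m)%R.
Proof. pose proof (mesh_lower m). pose proof (pos_INR m). lra. Qed.

(** By Taylor, p = M (exp (x / M) - 1) is within 5 |x|^2 / M <= |x| / 2 of x, so |p| >= |x| / 2 and
    |1 / p - 1 / x| <= 10 / M. *)
Lemma inv_exp1_near_0 (x : C) (M : R) :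
  x <> 0 -> (Cmod x <= M)%R -> (10 * Cmod x <= M)%R ->
  (Cmod (/ M * inv_exp1 (x / M) - / x) <= 10 / M)%R.
Proof.
  intros Hx HM1 HM. assert (Hx' : (0 < Cmod x)%R) by (apply Cmod_gt_0, Hx).
  assert (HM0 : RtoC M <> 0) by (apply RtoC_neq; lra).
  assert (Hm : Cmod (x / M) = (Cmod x / M)%R)
    by (rewrite Cmod_div, Cmod_R, Rabs_pos_eq by (assumption || lra); reflexivity).
  assert (Hle : (Cmod (x / M) <= 1)%R).
  { rewrite Hm. apply (Rmult_le_reg_r M); [lra |]. unfold Rdiv.
    rewrite Rmult_assoc, Rinv_l; lra. }
  pose proof (Cexp_taylor_1 _ Hle) as HT. rewrite Hm in HT.
  set (p := M * (Cexp (x / M) - 1)).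
  assert (Hp : (Cmod (x - p) <= 5 * Cmod x ^ 2 / M)%R).
  { replace (x - p) with (- (M * (Cexp (x / M) - 1 - x / M))) by (unfold p; field; exact HM0).
    rewrite Cmod_opp, Cmod_mult, Cmod_R, Rabs_pos_eq by lra.
    apply Rle_trans with (M * (5 * (Cmod x / M) ^ 2))%R; [apply Rmult_le_compat_l; lra |].
    right. field. lra. }
  assert (Hp' : (5 * Cmod x ^ 2 / M <= Cmod x / 2)%R).
  { apply (Rmult_le_reg_r M); [lra |]. unfold Rdiv.
    rewrite Rmult_assoc, Rinv_l by lra. nra. }
  assert (Hlow : (Cmod x / 2 <= Cmod p)%R).
  { pose proof (Cmod_triangle (x - p) p) as H. replace (x - p + p) with x in H by ring. lra. }
  assert (Hp0 : p <> 0) by (apply Cmod_gt_0; lra).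
  assert (He : Cexp (x / M) - 1 <> 0).
  { intros E. apply Hp0. unfold p. rewrite E. ring. }
  replace (/ M * inv_exp1 (x / M) - / x) with ((x - p) / (p * x)).
  - rewrite Cmod_div, Cmod_mult by (apply Cmult_neq_0; assumption).
    apply (Rmult_le_reg_r (Cmod p * Cmod x)); [nra |].
    unfold Rdiv at 1. rewrite Rmult_assoc, Rinv_l, Rmult_1_r by nra.
    apply Rle_trans with (1 := Hp).
    apply Rle_trans with (10 / M * (Cmod x / 2 * Cmod x))%R; [right; field; lra |].
    apply Rmult_le_compat_l; [apply Rdiv_le_0_compat; lra |].
    apply Rmult_le_compat_r; lra.
  - unfold p, inv_exp1. field. repeat split; assumption.
Qed.

(** The numerator exp y - exp x = exp x (exp (y - x) - 1) is at most 3 . 3 |y - x|, and each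
    denominator loses a factor 12: 1296 = 9 . 144. *)
Lemma inv_exp1_diff_bound (x y : C) :
  (Rabs (Re x) <= 1)%R -> (Rabs (Im x) <= 3 * PI / 2)%R ->
  (Rabs (Re y) <= 1)%R -> (Rabs (Im y) <= 3 * PI / 2)%R ->
  (Cmod (y - x) <= 1)%R -> x <> 0 -> y <> 0 ->
  (Cmod (inv_exp1 x - inv_exp1 y) <= 1296 * Cmod (y - x) / (Cmod x * Cmod y))%R.
Proof.
  intros Hx1 Hx2 Hy1 Hy2 Hxy Hx Hy.
  apply Cmod_gt_0 in Hx, Hy.
  pose proof (Cexp_minus_1_lower x Hx1 Hx2) as Lx.
  pose proof (Cexp_minus_1_lower y Hy1 Hy2) as Ly.
  pose proof (Cexp_minus_1_upper _ Hxy) as U.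
  assert (Nx : Cexp x - 1 <> 0) by (apply Cmod_gt_0; lra).
  assert (Ny : Cexp y - 1 <> 0) by (apply Cmod_gt_0; lra).
  assert (E : inv_exp1 x - inv_exp1 y =
    Cexp x * (Cexp (y - x) - 1) / ((Cexp x - 1) * (Cexp y - 1))).
  { replace (Cexp x * (Cexp (y - x) - 1)) with (Cexp y - Cexp x).
    - unfold inv_exp1. field. split; assumption.
    - rewrite Cexp_minus. field. apply Cexp_neq0. }
  rewrite E, Cmod_div, !Cmod_mult, Cmod_Cexp by (apply Cmult_neq_0; assumption).
  pose proof (exp_bounds_near_0 _ Hx1) as Ex.
  pose proof (Cmod_ge_0 (y - x)). pose proof (Cmod_ge_0 (Cexp (y - x) - 1)).
  apply Rle_trans with (9 * Cmod (y - x) * / (Cmod x / 12 * (Cmod y / 12)))%R.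
  - apply Rmult_le_compat.
    + nra.
    + apply Rlt_le, Rinv_0_lt_compat. nra.
    + nra.
    + apply Rinv_le_contravar; [nra |]. apply Rmult_le_compat; lra.
  - right. field. lra.
Qed.

Lemma Cmod_period (k : Z) : Cmod (period k) = (2 * PI * Rabs (IZR k))%R.
Proof.
  replace (period k) with ((2 * PI * IZR k)%R * Ci)
    by (unfold period, Cmult, Ci, RtoC; simpl; f_equal; ring).
  pose proof PI_RGT_0.
  rewrite Cmod_mult, Cmod_Ci, Cmod_R, !Rabs_mult, (Rabs_pos_eq 2), (Rabs_pos_eq PI) by lra.
  ring.
Qed.

Lemma Cmod_plus_period_lower (s : C) (k : Z) :
  (Cmod s <= Rabs (IZR k))%R -> (Rabs (IZR k) <= Cmod (s + period k))%R.
Proof.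
  intros H. pose proof (Cmod_triangle (s + period k) (- s)) as H1.
  replace (s + period k + - s) with (period k) in H1 by ring.
  rewrite Cmod_opp, Cmod_period in H1. pose proof PI2_1. pose proof (Rabs_pos (IZR k)). nra.
Qed.

Lemma plus_period_neq0 (s : C) (k : Z) : Cexp s <> 1 -> s + period k <> 0.
Proof.
  intros Hs H. apply Hs. rewrite <- Cexp_0, <- H, Cexp_plus, Cexp_period. ring.
Qed.

(** In the window |k| is at most half of [mesh m], so the imaginary part is at most PI + 1 <= 3 PI /
    2 in absolute value. *)
Lemma scaled_window_bound (s : C) (k : Z) (m : nat) :
  (Cmod s <= mesh m)%R -> In k (window m) ->
  (Rabs (Re ((s + period k) / mesh m)) <= 1)%R /\
  (Rabs (Im ((s + period k) / mesh m)) <= 3 * PI / 2)%R.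
Proof.
  intros Hs Hk. pose proof (mesh_pos m) as HM.
  assert (Hk' : (Rabs (IZR k) <= mesh m / 2)%R).
  { unfold mesh. rewrite mult_IZR. apply in_window in Hk. destruct Hk as [K1 K2].
    apply IZR_le in K1. apply IZR_lt in K2. rewrite opp_IZR in K1.
    apply Rabs_le_between. lra. }
  assert (HE : (s + period k) / mesh m = (/ mesh m)%R * (s + period k)).
  { rewrite RtoC_inv by lra. apply Cmult_comm. }
  rewrite HE, re_scal_l, im_scal_l, re_plus, im_plus.
  rewrite !Rabs_mult, (Rabs_pos_eq (/ mesh m)) by (apply Rlt_le, Rinv_0_lt_compat, HM).
  pose proof (re_le_Cmod s) as Hr. pose proof (im_le_Cmod s) as Hi. pose proof PI2_1.
  pose proof (Rabs_pos (IZR k)).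
  assert (HI : (Rabs (Im s + Im (period k)) <= Cmod s + 2 * PI * Rabs (IZR k))%R).
  { apply Rle_trans with (1 := Rabs_triang _ _). apply Rplus_le_compat; [exact Hi |].
    rewrite <- Cmod_period. apply im_le_Cmod. }
  split; apply (Rmult_le_reg_l (mesh m)); try exact HM;
    rewrite <- Rmult_assoc, Rinv_r, Rmult_1_l by lra.
  - simpl. rewrite Rplus_0_r. lra.
  - apply Rle_trans with (1 := HI). nra.
Qed.

(* Taking differences makes the sum over all integers absolutely convergent, so
   that no principal value is needed. *)
Lemma unordered_sum_inv_diff (s t : C) :
  Cexp s <> 1 -> Cexp t <> 1 ->
  is_unordered_sum (fun _ : Z => True)
    (fun k => / (s + period k) - / (t + period k)) (inv_exp1 s - inv_exp1 t).
Proof.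
  intros Hs Ht.
  pose proof (Cmod_ge_0 s) as Ps. pose proof (Cmod_ge_0 t) as Pt.
  pose proof (Cmod_ge_0 (t - s)) as Pts.
  (* For |k| >= K both |s + period k| and |t + period k| are at least |k| > 0. *)
  destruct (INR_unbounded (Cmod s + Cmod t + 1)) as [K HK].
  (* From n1 on, the scaled points lie in the strip and at distance at most 1 from each other. *)
  destruct (mesh_unbounded (Cmod s + Cmod t + Cmod (t - s))) as [n1 Hn1].
  assert (Hsmall : forall k,
    ~ In k (zball K) -> (INR K <= Rabs (IZR k))%R).
  { intros k Hk. rewrite <- abs_IZR, INR_IZR_INZ. apply IZR_le.
    apply Z.nlt_ge. intros Hlt. apply Hk, in_zball. lia. }
  assert (Hquot : forall k, (INR K <= Rabs (IZR k))%R ->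
    (Cmod (t - s) / (Cmod (s + period k) * Cmod (t + period k)) <=
     Cmod (t - s) * / IZR k ^ 2)%R).
  { intros k Hk. apply Rmult_le_compat_l; [exact Pts |].
    rewrite <- (pow2_abs (IZR k)).
    pose proof (Cmod_plus_period_lower s k ltac:(lra)).
    pose proof (Cmod_plus_period_lower t k ltac:(lra)).
    apply Rinv_le_contravar; nra. }
  apply unordered_sum_dominated with
    (v := fun n k => / mesh n * inv_exp1 ((s + period k) / mesh n)
                     - / mesh n * inv_exp1 ((t + period k) / mesh n))
    (W := window) (b := fun k => (1296 * Cmod (t - s) * / IZR k ^ 2)%R)
    (F1 := zball K)
    (n1 := n1).
  - apply inv_sqr_tail. lra.
  - intros k Hk. specialize (Hsmall k Hk). specialize (Hquot k Hsmall).
    pose proof (plus_period_neq0 s k Hs) as Hs0. pose proof (plus_period_neq0 t k Ht) as Ht0.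
    replace (/ (s + period k) - / (t + period k))
      with ((t - s) / ((s + period k) * (t + period k))) by (field; split; assumption).
    rewrite Cmod_div, Cmod_mult by (apply Cmult_neq_0; assumption).
    apply Rle_trans with (1 := Hquot). rewrite Rmult_assoc.
    assert (Hpos : (0 <= Cmod (t - s) * / IZR k ^ 2)%R).
    { apply Rle_trans with (2 := Hquot). apply Rdiv_le_0_compat; [exact Pts |].
      apply Rmult_lt_0_compat; apply Cmod_gt_0; assumption. }
    lra.
  - intros n k Hn HkW Hk. specialize (Hsmall k Hk). specialize (Hquot k Hsmall).
    specialize (Hn1 n Hn). pose proof (mesh_pos n) as HM.
    assert (HM0 : RtoC (mesh n) <> 0) by (apply RtoC_neq; lra).
    pose proof (plus_period_neq0 s k Hs) as Hs0. pose proof (plus_period_neq0 t k Ht) as Ht0.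
    destruct (scaled_window_bound s k n ltac:(lra) HkW) as [S1 S2].
    destruct (scaled_window_bound t k n ltac:(lra) HkW) as [T1 T2].
    set (x := (s + period k) / mesh n) in *. set (y := (t + period k) / mesh n) in *.
    assert (Hyx : Cmod (y - x) = (Cmod (t - s) / mesh n)%R).
    { replace (y - x) with ((t - s) / mesh n) by (unfold x, y; field; exact HM0).
      rewrite Cmod_div, Cmod_R, Rabs_pos_eq by (assumption || lra). reflexivity. }
    assert (Hx : Cmod x = (Cmod (s + period k) / mesh n)%R).
    { unfold x. rewrite Cmod_div, Cmod_R, Rabs_pos_eq by (assumption || lra). reflexivity. }
    assert (Hy : Cmod y = (Cmod (t + period k) / mesh n)%R).
    { unfold y. rewrite Cmod_div, Cmod_R, Rabs_pos_eq by (assumption || lra). reflexivity. }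
    assert (Hle : (Cmod (y - x) <= 1)%R).
    { rewrite Hyx. apply (Rmult_le_reg_r (mesh n)); [exact HM |]. unfold Rdiv.
      rewrite Rmult_assoc, Rinv_l; lra. }
    apply Cmod_gt_0 in Hs0, Ht0.
    assert (Hx0 : x <> 0) by (apply Cmod_gt_0; rewrite Hx; apply Rdiv_lt_0_compat; lra).
    assert (Hy0 : y <> 0) by (apply Cmod_gt_0; rewrite Hy; apply Rdiv_lt_0_compat; lra).
    pose proof (inv_exp1_diff_bound x y S1 S2 T1 T2 Hle Hx0 Hy0) as B.
    replace (/ mesh n * inv_exp1 x - / mesh n * inv_exp1 y)
      with ((inv_exp1 x - inv_exp1 y) / mesh n) by (field; exact HM0).
    rewrite Cmod_div, Cmod_R, Rabs_pos_eq by (assumption || lra).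
    rewrite Hx, Hy, Hyx in B.
    (* All powers of [mesh n] cancel, which makes the bound uniform in n. *)
    apply Rle_trans with
      (1296 * (Cmod (t - s) / (Cmod (s + period k) * Cmod (t + period k))))%R.
    + apply (Rmult_le_reg_r (mesh n)); [exact HM |].
      unfold Rdiv at 1. rewrite Rmult_assoc, Rinv_l, Rmult_1_r by lra.
      apply Rle_trans with (1 := B). right. field. lra.
    + rewrite Rmult_assoc. apply Rmult_le_compat_l; lra.
  - intros k eps Heps.
    pose proof (plus_period_neq0 s k Hs) as Hs0. pose proof (plus_period_neq0 t k Ht) as Ht0.
    (* Two errors of at most 10 / [mesh n] each; the other two summands are the size conditions of
       [inv_exp1_near_0]. *)
    destruct (mesh_unbounded (20 / eps + 10 * Cmod (s + period k) + 10 * Cmod (t + period k)))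
      as [n0 H0].
    exists n0. intros n Hn. specialize (H0 n Hn).
    pose proof (mesh_pos n) as HM.
    pose proof (Cmod_ge_0 (s + period k)). pose proof (Cmod_ge_0 (t + period k)).
    assert (He : (0 < 20 / eps)%R) by (apply Rdiv_lt_0_compat; lra).
    pose proof (inv_exp1_near_0 _ (mesh n) Hs0 ltac:(lra) ltac:(lra)) as B1.
    pose proof (inv_exp1_near_0 _ (mesh n) Ht0 ltac:(lra) ltac:(lra)) as B2.
    set (X := / mesh n * inv_exp1 ((s + period k) / mesh n)) in *.
    set (Y := / mesh n * inv_exp1 ((t + period k) / mesh n)) in *.
    replace (X - Y - (/ (s + period k) - / (t + period k)))
      with ((X - / (s + period k)) + - (Y - / (t + period k))) by ring.
    apply Rle_lt_trans with (1 := Cmod_triangle _ _). rewrite Cmod_opp.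
    apply Rle_lt_trans with (20 / mesh n)%R; [lra |].
    apply (Rmult_lt_reg_r (mesh n / eps)); [apply Rdiv_lt_0_compat; lra |].
    replace (20 / mesh n * (mesh n / eps))%R with (20 / eps)%R by (field; lra).
    replace (eps * (mesh n / eps))%R with (mesh n) by (field; lra). lra.
  - intros k. exists (Z.abs_nat k). intros n Hn. apply in_window.
    pose proof (Z.pow_gt_lin_r 2 (Z.of_nat n)). lia.
  - apply NoDup_window.
  - intros n. rewrite (inv_exp1_window s n Hs), (inv_exp1_window t n Ht).
    rewrite <- !list_sum_scal. unfold Cminus.
    rewrite list_sum_plus. f_equal.
    replace (- list_sum (fun k => / mesh n * inv_exp1 ((t + period k) / mesh n)) (window n))
      with (- (1) * list_sum (fun k => / mesh n * inv_exp1 ((t + period k) / mesh n)) (window n))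
      by ring.
    rewrite <- list_sum_scal. apply list_sum_ext_in. intros k _. ring.
Qed.

(** * The Ruelle sum of [gamma] *)

(** The residues at 0, 1 and a are a - 1, - a and 1; they add up to 0, which permits a grouping into
    differences, each absolutely summable over the branches. *)
Lemma gamma_partial_fractions (a w : C) :
  w <> 0 -> w <> 1 -> w <> a ->
  gamma a w = (a - 1) * (/ w - / (w - a)) - a * (/ (w - 1) - / (w - a)).
Proof.
  intros H0 H1 Ha. apply Cminus_eq_contra in H1, Ha. unfold gamma. field.
  repeat split; assumption.
Qed.

Lemma is_Ruelle_fexp_gamma (lambda a z : C) :
  lambda <> 0 -> z <> 0 ->
  z <> fexp lambda 0 -> z <> fexp lambda 1 -> z <> fexp lambda a ->
  is_Ruelle (fexp lambda) (gamma a) z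
    (1 / C_derive (fexp lambda) a * gamma (fexp lambda a) z
     - a / C_derive (fexp lambda) 1 * gamma (fexp lambda 1) z).
Proof.
  intros Hl Hz Hz0 Hz1 Hza.
  destruct (Cexp_surj z Hz) as [L HL].
  (* No branch takes the value c at z, so L - lambda c is not a multiple of 2 pi i. *)
  assert (N : forall c, z <> fexp lambda c -> Cexp (L - lambda * c) <> 1).
  { intros c Hc H. apply Hc. unfold fexp. rewrite Cexp_minus, HL in H.
    rewrite <- (Cmult_1_l (Cexp (lambda * c))), <- H. field. apply Cexp_neq0. }
  assert (S : forall c, z <> fexp lambda c ->
    inv_exp1 (L - lambda * c) = fexp lambda c / (z - fexp lambda c)).
  { intros c Hc. unfold inv_exp1. rewrite Cexp_minus, HL. fold (fexp lambda c). field.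
    split; [apply Cminus_eq_contra, Hc | apply Cexp_neq0]. }
  unfold is_Ruelle.
  apply is_unordered_sum_reindex with (f := fun k => germ z (fexp_branch lambda z L k)).
  { intros j k. apply germ_fexp_branch_inj; assumption. }
  { intros G. apply branch_germ_fexp; assumption. }
  (* The residues at 0 and 1, times the squared derivative 1 / (lambda z)^2, times the lambda
     released by 1 / (xi - c) = lambda / (L - lambda c + 2 pi i k). *)
  set (A := (a - 1) / (lambda * z ^ 2)). set (B := - a / (lambda * z ^ 2)).
  apply is_unordered_sum_ext with (u := fun k =>
    A * (/ (L - lambda * 0 + period k) - / (L - lambda * a + period k)) +
    B * (/ (L - lambda * 1 + period k) - / (L - lambda * a + period k))).
  { intros k. rewrite ruelle_term_fexp_branch by assumption.
    pose proof (plus_period_neq0 _ k (N _ Hz0)) as P0.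
    pose proof (plus_period_neq0 _ k (N _ Hz1)) as P1.
    pose proof (plus_period_neq0 _ k (N _ Hza)) as Pa.
    assert (Hc : forall c, L - lambda * c + period k <> 0 -> (L + period k) / lambda <> c).
    { intros c H E. apply H. rewrite <- E. field. exact Hl. }
    rewrite gamma_partial_fractions by (apply Hc; assumption).
    assert (Hi : forall c, L - lambda * c + period k <> 0 ->
      / ((L + period k) / lambda - c) = lambda / (L - lambda * c + period k)).
    { intros c H. field. split; assumption. }
    rewrite (Hi _ P1), (Hi _ Pa).
    replace (/ ((L + period k) / lambda)) with (lambda / (L - lambda * 0 + period k)).
    - clear Hc Hi. revert P0 P1 Pa. unfold A, B.
      generalize (L - lambda * 0 + period k) (L - lambda * 1 + period k)
        (L - lambda * a + period k).
      intros x y w P0 P1 Pa. field. repeat split; assumption.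
    - rewrite <- (Hi _ P0). f_equal. ring. }
  rewrite !(is_C_derive_unique _ _ _ (is_derive_fexp lambda _)).
  assert (V : forall c, z <> fexp lambda c -> z - fexp lambda c <> 0)
    by (intros c; apply Cminus_eq_contra).
  replace (1 / (lambda * fexp lambda a) * gamma (fexp lambda a) z
     - a / (lambda * fexp lambda 1) * gamma (fexp lambda 1) z)
    with (A * (inv_exp1 (L - lambda * 0) - inv_exp1 (L - lambda * a)) +
          B * (inv_exp1 (L - lambda * 1) - inv_exp1 (L - lambda * a))).
  - apply is_unordered_sum_plus; apply is_unordered_sum_scal;
      apply unordered_sum_inv_diff; apply N; assumption.
  - rewrite !S by assumption.
    (* The pole of [gamma a] at 0 thus yields the factor z - 1 shared by both terms on the right. *)
    assert (E0 : fexp lambda 0 = 1).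
    { unfold fexp. rewrite Cmult_0_r. apply Cexp_0. }
    pose proof (V _ Hz0) as V0. pose proof (V _ Hz1) as V1. pose proof (V _ Hza) as Va.
    rewrite E0 in *. unfold A, B, gamma. field.
    repeat split; try assumption; apply Cexp_neq0.
Qed.

(** The finitely many excluded points are 0, which f omits, and the images under f of the poles 0,
    1, a of [gamma a], where a branch runs into a pole. The identity therefore holds almost
    everywhere, as befits an operator on L_1. *)
Theorem proposition2 (lambda a : C)
    (lambda_neq0 : lambda <> RtoC 0)
    (a_neq0 : a <> RtoC 0) (a_neq1 : a <> RtoC 1)
    (z : C) (z_neq0 : z <> RtoC 0)
    (z_neqf0 : z <> fexp lambda 0)
    (z_neqf1 : z <> fexp lambda 1)
    (z_neqfa : z <> fexp lambda a) :
  ex_Ruelle (fexp lambda) (gamma a) z /\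
  Ruelle (fexp lambda) (gamma a) z =
    1 / C_derive (fexp lambda) a * gamma (fexp lambda a) z
    - a / C_derive (fexp lambda) 1 * gamma (fexp lambda 1) z.
Proof.
  pose proof (is_Ruelle_fexp_gamma lambda a z lambda_neq0 z_neq0 z_neqf0 z_neqf1 z_neqfa)
    as H.
  split; [eexists; exact H |].
  apply is_unordered_sum_unique with (2 := H). unfold Ruelle. apply epsilon_spec.
  eexists. exact H.
Qed.
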